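(* Let $\mathcal{M},\mathcal{N}$ be von Neumann algebras and let $\Phi_i,\Psi_i\in\mathrm{CP}(\mathcal{M},\mathcal{N})$ for $i=1,2$. Then \[ (\Phi_1:\Psi_1)+(\Phi_2:\Psi_2)\le_{\mathrm{cp}}(\Phi_1+\Phi_2):(\Psi_1+\Psi_2). \]
   Context: $\mathrm{CP}(\mathcal{M},\mathcal{N})$ is the set of all completely positive (CP) maps $\mathcal{M}\to\mathcal{N}$ (not assumed normal). $\Phi\le_{\mathrm{cp}}\Psi$ means $\Psi-\Phi$ is CP. Forms: for a complex vector space $\mathcal{V}$, $F_+(\mathcal{V})$ is the set of positive sesquilinear forms on $\mathcal{V}$ (linear in the first variable). A compatible representation of $\alpha,\beta\in F_+(\mathcal{V})$ consists of a linear map $h$ from $\mathcal{V}$ onto a dense subspace of a Hilbert space $\mathcal{H}$ and commuting positive $A,B\in\mathbb{B}(\mathcal{H})$ with $\alpha(x,y)=\langle Ah(x),h(y)\rangle$, $\beta(x,y)=\langle Bh(x),h(y)\rangle$. By Pusz–Woronowicz such representations always exist, and for a homogeneous locally bounded Borel function $f$ on $[0,\infty)^2$ the form $f(\alpha,\beta)(x,y):=\langle f(A,B)h(x),h(y)\rangle$ does not depend on the choice. The parallel sum is $\alpha:\beta:=f(\alpha,\beta)$ with $f(r,s)=\frac{rs}{r+s}$ (and $0/0=0$). CP maps: $L^2(\mathcal{N})$ is the standard form Hilbert space of $\mathcal{N}$. For $\Phi\in\mathrm{CP}(\mathcal{M},\mathcal{N})$, $s_\Phi$ is the positive sesquilinear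 form on the algebraic tensor product $\mathcal{M}\odot L^2(\mathcal{N})$ given by $s_\Phi(x\otimes\xi,y\otimes\eta)=\langle\Phi(y^*x)\xi,\eta\rangle$. The parallel sum $\Phi:\Psi\in\mathrm{CP}(\mathcal{M},\mathcal{N})$ is the unique CP map with $\langle(\Phi:\Psi)(y^*x)\xi,\eta\rangle=(s_\Phi:s_\Psi)(x\otimes\xi,y\otimes\eta)$ for all $x,y\in\mathcal{M}$, $\xi,\eta\in L^2(\mathcal{N})$. *)

(* Defs.v *)
From HB Require Import structures.
From mathcomp Require Import all_boot all_order all_algebra generic_quotient.
From mathcomp Require Import sesquilinear complex.
From mathcomp Require Import all_classical all_reals all_analysis.

Set Implicit Arguments.
Unset Strict Implicit.
Unset Printing Implicit Defensive.

Import Order.TTheory GRing.Theory Num.Theory numFieldNormedType.Exports.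

Local Open Scope quotient_scope.
Local Open Scope classical_set_scope.
Local Open Scope ring_scope.
Local Open Scope complex_scope.

(* The inner product is linear in the first variable and conjugate-linear in
   the second one; positive definiteness is part of [{dot _ for _}]. *)
Record hilbert (R : realType) := Hilbert {
  hcarrier :> completeNormedModType R[i] ;
  hdot : {dot hcarrier for Num.conj} ;
  hdotE : forall x : hcarrier, hdot x x = `|x| ^+ 2 }.

Definition dotp {R : realType} {H : hilbert R} (x y : H) : R[i] := hdot H x y.

Section InnerProduct.
Context {R : realType} {H : hilbert R}.
Implicit Types x y z : H.

Lemma dotpPl a x y z : dotp (a *: x + y) z = a * dotp x z + dotp y z.
Proof. exact: linearPl. Qed.

Lemma dotpPr a x y z : dotp z (a *: x + y) = a^*%C * dotp z x + dotp z y.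
Proof. exact: linearPr. Qed.

Lemma dotpBr x y z : dotp x (y - z) = dotp x y - dotp x z.
Proof. exact: linearBr. Qed.

Lemma dotp_eq0 x : dotp x x = 0 -> x = 0.
Proof. by rewrite /dotp hdotE => /eqP; rewrite sqrf_eq0 normr_eq0 => /eqP. Qed.

Lemma dotp_ext y z : (forall x, dotp x y = dotp x z) -> y = z.
Proof.
move=> yz; apply/eqP; rewrite -subr_eq0; apply/eqP/dotp_eq0.
by rewrite dotpBr yz subrr.
Qed.

End InnerProduct.

Section Operators.
Context {R : realType} {H : hilbert R}.
Implicit Types (S T : H -> H) (A : set (H -> H)).

Definition boundedop T : Prop := linear T /\ continuous T.

Definition adjoint_of T S : Prop := forall x y, dotp (T x) y = dotp x (S y).

(* The default value 0 is never used on bounded operators. *)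
Definition adj T : H -> H := xget 0 [set S | boundedop S /\ adjoint_of T S].

Definition posop T : Prop := boundedop T /\ forall x, 0 <= dotp (T x) x.

Definition commutant A : set (H -> H) :=
  [set T | boundedop T /\ forall S, A S -> T \o S = S \o T].

End Operators.

Record vonNeumann {R : realType} (H : hilbert R) := VonNeumann {
  vnset : set (H -> H) ;
  vn_adj : forall T, vnset T -> exists2 S, vnset S & adjoint_of T S ;
  vn_bicommutant : commutant (commutant vnset) = vnset }.

Section VNElements.
Context {R : realType} {H : hilbert R}.
Implicit Types (M : vonNeumann H) (S T : H -> H).

Lemma vn_bounded M T : vnset M T -> boundedop T.
Proof. by rewrite -vn_bicommutant => -[]. Qed.

Lemma vnset_adj M T : vnset M T -> vnset M (adj T) /\ adjoint_of T (adj T).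
Proof.
move=> MT; have [S MS TS] := vn_adj MT.
have [_ TT'] : boundedop (adj T) /\ adjoint_of T (adj T).
  have ex : exists S, [set S | boundedop S /\ adjoint_of T S] S.
    by exists S; split=> //; exact: vn_bounded MS.
  exact: (xgetPex 0 ex).
suff -> : adj T = S by [].
by apply/funext => y; apply: dotp_ext => x; rewrite -TT' -TS.
Qed.

Lemma vnset_comp M S T : vnset M S -> vnset M T -> vnset M (S \o T).
Proof.
move=> MS MT; have [linS ctsS] := vn_bounded MS.
have [linT ctsT] := vn_bounded MT.
rewrite -vn_bicommutant; split.
  split; first by move=> a x y /=; rewrite linT linS.
  by move=> x; apply: continuous_comp; [exact: ctsT|exact: ctsS].
move=> U [_ cU]; apply/funext => x /=.
by rewrite -[T (U x)]/((T \o U) x) -(cU _ MT) /= -[S (U _)]/((S \o U) _)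
  -(cU _ MS).
Qed.

Definition vn_pred M : {pred H -> H} := fun T => `[< vnset M T >].

Lemma vn_predP M T : reflect (vnset M T) (T \in vn_pred M).
Proof. exact: asboolP. Qed.

Lemma vn_submod_closed M : submod_closed (vn_pred M).
Proof.
split.
  apply/vn_predP; rewrite -vn_bicommutant; split.
    split; first by move=> a x y; rewrite /= scaler0 addr0.
    by move=> x; exact: cst_continuous.
  move=> U [[linU _] _]; apply/funext => x /=.
  by have := linU (-1) 0 0; rewrite scaleN1r addNr => ->;
    rewrite scaleN1r addNr.
move=> a S T /vn_predP MS /vn_predP MT; apply/vn_predP.
have [linS ctsS] := vn_bounded MS; have [linT ctsT] := vn_bounded MT.
rewrite -vn_bicommutant; split.
  split.
    move=> c x y; rewrite /= !fctE linS linT !scalerDr !scalerA (mulrC a c).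
    by rewrite -!addrA; congr (_ + _); rewrite addrCA.
  move=> x; apply: (@continuousD _ _ _ (fun x => a *: S x) T); last exact: ctsT.
  by apply: (@cvgZ _ _ _ _ _ (fun=> a) S); [exact: cvg_cst|exact: ctsS].
move=> U [[linU _] cU]; apply/funext => x; rewrite /= !fctE linU.
rewrite -[U (S x)]/((U \o S) x) -[U (T x)]/((U \o T) x).
by rewrite (cU _ MS) (cU _ MT).
Qed.

HB.instance Definition _ M :=
  GRing.isSubmodClosed.Build _ _ (vn_pred M) (vn_submod_closed M).

Record vn_elt M := VNElt { vn_op :> H -> H ; vn_opP : vn_op \in vn_pred M }.

HB.instance Definition _ M := [isSub of vn_elt M for @vn_op M].
HB.instance Definition _ M := [Choice of vn_elt M by <:].
HB.instance Definition _ M := [SubChoice_isSubLmodule of vn_elt M by <:].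

Lemma vn_mul_subproof M (x y : vn_elt M) : (x : H -> H) \o y \in vn_pred M.
Proof. by apply/vn_predP/vnset_comp; apply/vn_predP/vn_opP. Qed.

Lemma vn_star_subproof M (x : vn_elt M) : adj x \in vn_pred M.
Proof. by apply/vn_predP; have /vn_predP/vnset_adj[] := vn_opP x. Qed.

Definition vn_mul M (x y : vn_elt M) : vn_elt M := VNElt (vn_mul_subproof x y).
Definition vn_star M (x : vn_elt M) : vn_elt M := VNElt (vn_star_subproof x).

Lemma vn_linear M (x : vn_elt M) : linear x.
Proof. by have /vn_predP/vn_bounded[] := vn_opP x. Qed.

Lemma vn_starP M (x : vn_elt M) u v : dotp (x u) v = dotp u (vn_star x v).
Proof. by have /vn_predP/vnset_adj[_] := vn_opP x; exact. Qed.

Lemma vn_mulPr M (a : R[i]) (x y z : vn_elt M) :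
  vn_mul x (a *: y + z) = a *: vn_mul x y + vn_mul x z.
Proof. by apply: val_inj; apply/funext => u; exact: vn_linear. Qed.

Lemma vn_mul_starPl M (a : R[i]) (x y z : vn_elt M) :
  vn_mul (vn_star (a *: y + z)) x =
  a^*%C *: vn_mul (vn_star y) x + vn_mul (vn_star z) x.
Proof.
apply: val_inj; apply/funext => u; apply: dotp_ext => v.
rewrite [RHS]dotpPr conjcK -[LHS]vn_starP.
by rewrite -[dotp v (vn_mul _ _ u)]vn_starP -[dotp v (vn_mul _ _ u)]vn_starP -dotpPl.
Qed.

End VNElements.

Coercion vn_elt : vonNeumann >-> Sortclass.

(* *-isomorphisms of von Neumann algebras; normality is automatic. *)
Definition star_iso {R : realType} {H L : hilbert R} (M : vonNeumann H)
    (N : vonNeumann L) (pi : M -> N) : Prop :=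
  [/\ linear pi, bijective pi,
      forall x y, pi (vn_mul x y) = vn_mul (pi x) (pi y) &
      forall x, pi (vn_star x) = vn_star (pi x)].

(* Positivity of a matrix over M as an operator on the n-fold sum of H. *)
Definition mxpos {R : realType} {H : hilbert R} (M : vonNeumann H) (n : nat)
    (X : 'M[M]_n) : Prop :=
  forall xi : 'I_n -> H, 0 <= \sum_i \sum_j dotp (X i j (xi j)) (xi i).

Section CP.
Context {R : realType} {H L : hilbert R} {M : vonNeumann H} {N : vonNeumann L}.

Definition is_cp (Phi : M -> N) : Prop :=
  linear Phi /\
  forall (n : nat) (X : 'M[M]_n), mxpos X -> mxpos (map_mx Phi X).

Definition cp_le (Phi Psi : M -> N) : Prop := is_cp (Psi \- Phi).

End CP.

(* Haagerup's axioms for a standard form (N, H, J, P). *)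
Record is_standard {R : realType} {H : hilbert R} (N : vonNeumann H)
    (J : H -> H) (P : set H) : Prop := IsStandard {
  std_conjlinear : forall (a : R[i]) x y, J (a *: x + y) = a^* *: J x + J y ;
  std_isometry : forall x, `|J x| = `|x| ;
  std_involution : involutive J ;
  std_selfdual : P = [set x | forall y, P y -> 0 <= dotp x y] ;
  std_commutant : [set J \o T \o J | T in vnset N] = commutant (vnset N) ;
  std_center : forall T, vnset N T -> commutant (vnset N) T ->
    J \o T \o J = adj T ;
  std_fixed : forall x, P x -> J x = x ;
  std_cone : forall T x, vnset N T -> P x -> P (T (J (T (J x)))) }.

(* The standard form is unique up to unitary equivalence, so L^2(N) is any
   Hilbert space on which N is represented in standard form. *)
Record standard_form {R : realType} {L : hilbert R} (N : vonNeumann L) := {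
  L2 : hilbert R ;
  L2alg : vonNeumann L2 ;
  L2rep : N -> L2alg ;
  L2rep_iso : star_iso L2rep ;
  L2conj : L2 -> L2 ;
  L2cone : set L2 ;
  L2_standard : is_standard L2alg L2conj L2cone }.

(* Finite formal sums of pairs, where two formal sums are identified as soon as
   every bilinear map takes the same value on them.  Scalars need not appear in
   formal sums as they can be absorbed by the left components. *)
Section Tensor.
Context {K : comNzRingType} (U V : lmodType K).

Definition bisum (W : lmodType K) (b : U -> V -> W) (s : seq (U * V)) : W :=
  \sum_(p <- s) b p.1 p.2.

Definition tens_eq (s t : seq (U * V)) : bool :=
  `[< forall (W : lmodType K) (b : U -> V -> W),
        bilinear_for *:%R *:%R b -> bisum b s = bisum b t >].

Lemma tens_eq_refl : reflexive tens_eq.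
Proof. by move=> s; apply/asboolP. Qed.

Lemma tens_eq_sym : symmetric tens_eq.
Proof. by move=> s t; apply/asboolP/asboolP => e W b /e ->. Qed.

Lemma tens_eq_trans : transitive tens_eq.
Proof.
move=> t s u /asboolP st /asboolP tu; apply/asboolP => W b bb.
by rewrite st// tu.
Qed.

Canonical tens_equiv := EquivRel tens_eq tens_eq_refl tens_eq_sym tens_eq_trans.

Definition tensor : Type := {eq_quot tens_eq}.

HB.instance Definition _ := Choice.on tensor.
HB.instance Definition _ := EqQuotient.on tensor.

Definition pure (u : U) (v : V) : tensor := \pi_tensor [:: (u, v)].

Definition tens_lift (W : lmodType K) (b : U -> V -> W) (x : tensor) : W :=
  bisum b (repr x).

Lemma tens_lift_pi (W : lmodType K) (b : U -> V -> W) s :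
  bilinear_for *:%R *:%R b -> tens_lift b (\pi_tensor s) = bisum b s.
Proof.
move=> bb; have /eqmodP/asboolP e : repr (\pi_tensor s) = s %[mod tensor].
  by rewrite reprK.
exact: e.
Qed.

Lemma tens_ext (x y : tensor) :
  (forall (W : lmodType K) (b : U -> V -> W), bilinear_for *:%R *:%R b ->
     tens_lift b x = tens_lift b y) -> x = y.
Proof.
by move=> e; rewrite -[x]reprK -[y]reprK; apply/eqmodP/asboolP.
Qed.

Definition scale_sum (a : K) (s : seq (U * V)) := [seq (a *: p.1, p.2) | p <- s].

Lemma bisum_scale (W : lmodType K) (b : U -> V -> W) a s :
  bilinear_for *:%R *:%R b -> bisum b (scale_sum a s) = a *: bisum b s.
Proof.
move=> [bl _]; rewrite /bisum big_map scaler_sumr; apply: eq_bigr => p _ /=.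
have b0 : b 0 p.2 = 0.
  by have /= := bl p.2 (-1) 0 0; rewrite scaler0 addr0 scaleN1r addNr.
by have /= := bl p.2 a p.1 0; rewrite !addr0 b0 addr0.
Qed.

Definition tens_zero : tensor := \pi_tensor [::].
Definition tens_add (x y : tensor) : tensor := \pi_tensor (repr x ++ repr y).
Definition tens_scale (a : K) (x : tensor) : tensor :=
  \pi_tensor (scale_sum a (repr x)).

Section Lift.
Variables (W : lmodType K) (b : U -> V -> W).
Hypothesis bb : bilinear_for *:%R *:%R b.

Lemma tens_lift0 : tens_lift b tens_zero = 0.
Proof. by rewrite tens_lift_pi// /bisum big_nil. Qed.

Lemma tens_liftD x y :
  tens_lift b (tens_add x y) = tens_lift b x + tens_lift b y.
Proof. by rewrite tens_lift_pi// /bisum big_cat. Qed.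

Lemma tens_liftZ a x : tens_lift b (tens_scale a x) = a *: tens_lift b x.
Proof. by rewrite tens_lift_pi// bisum_scale. Qed.

End Lift.

Lemma tens_addA : associative tens_add.
Proof. by move=> x y z; apply: tens_ext => W b bb; rewrite !tens_liftD// addrA. Qed.

Lemma tens_addC : commutative tens_add.
Proof. by move=> x y; apply: tens_ext => W b bb; rewrite !tens_liftD// addrC. Qed.

Lemma tens_add0 : left_id tens_zero tens_add.
Proof.
by move=> x; apply: tens_ext => W b bb; rewrite tens_liftD// tens_lift0// add0r.
Qed.

Lemma tens_addN : left_inverse tens_zero (tens_scale (-1)) tens_add.
Proof.
move=> x; apply: tens_ext => W b bb.
by rewrite tens_liftD// tens_liftZ// tens_lift0// scaleN1r addNr.
Qed.

HB.instance Definition _ :=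
  GRing.isZmodule.Build tensor tens_addA tens_addC tens_add0 tens_addN.

Lemma tens_scaleA a c x : tens_scale a (tens_scale c x) = tens_scale (a * c) x.
Proof. by apply: tens_ext => W b bb; rewrite !tens_liftZ// scalerA. Qed.

Lemma tens_scale1 : left_id 1 tens_scale.
Proof. by move=> x; apply: tens_ext => W b bb; rewrite !tens_liftZ// scale1r. Qed.

Lemma tens_scaleDr : right_distributive tens_scale +%R.
Proof.
move=> a x y; apply: tens_ext => W b bb.
by rewrite !(tens_liftZ, tens_liftD)// scalerDr.
Qed.

Lemma tens_scaleDl x : {morph tens_scale^~ x : a c / a + c}.
Proof.
move=> a c; apply: tens_ext => W b bb.
by rewrite !(tens_liftZ, tens_liftD)// scalerDl.
Qed.

HB.instance Definition _ := GRing.Zmodule_isLmodule.Build K tensor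
  tens_scaleA tens_scale1 tens_scaleDr tens_scaleDl.

Lemma pure_bilinear : bilinear_for *:%R *:%R pure.
Proof.
split=> [v|u] a x y; apply: tens_ext => W b bb;
  rewrite tens_liftD// tens_liftZ// !tens_lift_pi// /bisum !big_seq1 /=.
- exact: bb.1.
- exact: bb.2.
Qed.

Lemma tens_lift_linear (W : lmodType K) (b : U -> V -> W) :
  bilinear_for *:%R *:%R b -> linear (tens_lift b).
Proof. by move=> bb a x y; rewrite tens_liftD// tens_liftZ. Qed.

Lemma tens_lift_pure (W : lmodType K) (b : U -> V -> W) u v :
  bilinear_for *:%R *:%R b -> tens_lift b (pure u v) = b u v.
Proof. by move=> bb; rewrite tens_lift_pi// /bisum big_seq1. Qed.

Lemma tens_sum_pure (x : tensor) : x = \sum_(p <- repr x) pure p.1 p.2.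
Proof.
rewrite -[LHS]reprK; elim: (repr x) => [|[u v] s IH]; first by rewrite big_nil.
rewrite big_cons -IH; apply: tens_ext => W b bb.
by rewrite tens_liftD// !tens_lift_pi// /bisum big_seq1 big_cons.
Qed.

End Tensor.

Section Calculus.
Context {R : realType} {H : hilbert R}.
Local Notation quadrant := [set z : R * R | 0 <= z.1 /\ 0 <= z.2].

(* [E] is the joint spectral measure on [0, +oo[ ^ 2 of the commuting positive
   operators [A] and [B], and [mu x] is the scalar measure <E(.)x, x>. *)
Record joint_spectral_measure (A B : H -> H) (E : set (R * R) -> H -> H)
    (mu : H -> {measure set (R * R) -> \bar R}) : Prop := JointSpectralMeasure {
  jsm_bounded : forall S, measurable S -> boundedop (E S) ;
  jsm_selfadjoint : forall S, measurable S -> adjoint_of (E S) (E S) ;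
  jsm_setI : forall S T, measurable S -> measurable T ->
    E (S `&` T) = E S \o E T ;
  jsm_setT : E setT = id ;
  jsm_quadrant : E quadrant = id ;
  jsm_measure : forall x S, measurable S -> mu x S = (complex.Re (dotp (E S x) x))%:E ;
  jsm_fst : forall x, (mu x).-integrable setT (EFin \o fst) /\
    dotp (A x) x = (\int[mu x]_z z.1)%R%:C ;
  jsm_snd : forall x, (mu x).-integrable setT (EFin \o snd) /\
    dotp (B x) x = (\int[mu x]_z z.2)%R%:C }.

(* [F] is f(A, B), i.e. the integral of f against the joint spectral measure. *)
Definition is_calculus (f : R * R -> R) (A B F : H -> H) : Prop :=
  exists (E : set (R * R) -> H -> H) (mu : H -> {measure set (R * R) -> \bar R}),
    [/\ joint_spectral_measure A B E mu, boundedop F &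
        forall x, (mu x).-integrable setT (EFin \o f) /\
          dotp (F x) x = (\int[mu x]_z f z)%R%:C].

End Calculus.

Section Forms.
Context {R : realType} {V : lmodType R[i]}.
Implicit Types alpha beta gamma : V -> V -> R[i].

Record compatible_rep alpha beta (H : hilbert R) (h : V -> H) (A B : H -> H) :
    Prop := CompatibleRep {
  crep_linear : linear h ;
  crep_dense : dense (range h) ;
  crep_posA : posop A ;
  crep_posB : posop B ;
  crep_comm : A \o B = B \o A ;
  crep_alpha : forall x y, alpha x y = dotp (A (h x)) (h y) ;
  crep_beta : forall x y, beta x y = dotp (B (h x)) (h y) }.

(* [gamma] is f(alpha, beta): as this form does not depend on the compatible
   representation, it is enough that some representation yields [gamma]. *)
Definition is_form_calculus (f : R * R -> R) alpha beta gamma : Prop :=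
  exists (H : hilbert R) (h : V -> H) (A B F : H -> H),
    [/\ compatible_rep alpha beta h A B, is_calculus f A B F &
        forall x y, gamma x y = dotp (F (h x)) (h y)].

(* Division by zero is zero, so this function vanishes at the origin. *)
Definition parallel_fun (z : R * R) : R := z.1 * z.2 / (z.1 + z.2).

Definition is_form_parallel alpha beta gamma : Prop :=
  is_form_calculus parallel_fun alpha beta gamma.

End Forms.

Section ParallelSum.
Context {R : realType} {H L : hilbert R} {M : vonNeumann H} {N : vonNeumann L}.
Variable SF : standard_form N.

Definition cp_form (Phi : M -> N) (s t : tensor M (L2 SF)) : R[i] :=
  \sum_(p <- repr s) \sum_(q <- repr t)
    dotp (L2rep SF (Phi (vn_mul (vn_star q.1) p.1)) p.2) q.2.

Lemma cp_form_pure (Phi : M -> N) (x y : M) (xi eta : L2 SF) : linear Phi ->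
  cp_form Phi (pure x xi) (pure y eta) =
  dotp (L2rep SF (Phi (vn_mul (vn_star y) x)) xi) eta.
Proof.
move=> linPhi; have [linrep _ _ _] := L2rep_iso SF.
pose b q (u : M) (v : L2 SF) : R[i]^o :=
  dotp (L2rep SF (Phi (vn_mul (vn_star q.1) u)) v) q.2.
have bb q : bilinear_for *:%R *:%R (b q).
  split=> [v|u] a z w; rewrite /b; last by rewrite vn_linear dotpPl.
  by rewrite vn_mulPr linPhi linrep -dotpPl.
pose c (p : M * L2 SF) (u : M) (v : L2 SF) : R[i]^o := (b (u, v) p.1 p.2)^*.
have cb p : bilinear_for *:%R *:%R (c p).
  split=> [v|u] a z w; rewrite /c /b /=.
    by rewrite vn_mul_starPl linPhi linrep [X in X^*]dotpPl rmorphD rmorphM /= conjcK.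
  by rewrite dotpPr rmorphD rmorphM /= conjcK.
rewrite /cp_form exchange_big /=.
under eq_bigr => q _.
  rewrite -[\sum_(p <- _) _]/(tens_lift (b q) (pure x xi)) tens_lift_pure//.
  rewrite -[b q x xi]conjcK -[(b q x xi)^*]/((c (x, xi) q.1 q.2)).
  over.
rewrite -rmorph_sum -[\sum_(q <- _) _]/(tens_lift (c (x, xi)) (pure y eta)).
by rewrite tens_lift_pure//; exact: conjcK.
Qed.

(* Graph of the parallel sum: [Theta] is the parallel sum of [Phi] and [Psi],
   the CP map determined by the parallel sum of their forms. *)
Definition is_parallel_sum (Phi Psi Theta : M -> N) : Prop :=
  is_cp Theta /\
  exists2 gamma : tensor M (L2 SF) -> tensor M (L2 SF) -> R[i],
    is_form_parallel (cp_form Phi) (cp_form Psi) gamma &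
    forall (x y : M) (xi eta : L2 SF),
      dotp (L2rep SF (Theta (vn_mul (vn_star y) x)) xi) eta =
      gamma (pure x xi) (pure y eta).

End ParallelSum.

(* Main.v *)
(* For F = f(A, B), f(r, s) = r s / (r + s), spectral calculus gives
   F (A + B) = A B, whence by completing the square
     <F u, u> = inf_v <A v, v> + <B (u - v), u - v>.
   Thus (alpha : beta)(x, x) is the infimum of alpha(y, y) + beta(x - y, x - y)
   over y, which is superadditive in (alpha, beta).  For complete positivity, a
   positive matrix over M is Z^* Z for some matrix Z over M (square roots are
   limits of polynomials, so they stay in the algebra), and on Z^* Z the pairing
   of a CP map with vectors is a sum of values of its form on
   sum_j Z_kj (x) xi_j.  As the forms live on L^2(N) while positivity is asked
   on the space of N, the same factorization transports positivity along the
   *-isomorphism. *)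
From HB Require Import structures.
Require Import Defs.
From mathcomp Require Import all_boot all_order all_algebra.
From mathcomp Require Import sesquilinear complex.
From mathcomp Require Import all_classical all_reals all_analysis.
From mathcomp Require Import measurable_realfun measurable_fun_approximation.
From mathcomp Require Import ring lra.

Set Implicit Arguments.
Unset Strict Implicit.
Unset Printing Implicit Defensive.

Import Order.TTheory GRing.Theory Num.Theory numFieldNormedType.Exports.

Local Open Scope classical_set_scope.
Local Open Scope ring_scope.
Local Open Scope complex_scope.

(* Plain [Re] and [Im] are the operations of numClosedFieldType. *)
Local Notation Re := complex.Re.
Local Notation Im := complex.Im.

(** * Positive semidefinite real forms *)

(** The three parallel sums come with three unrelated compatible representations, so their operators
    cannot be compared directly. The infimum formula mentions only the forms, and this is what makes
    them comparable. The infimum need not be attained, because [A + B] need not be invertible and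
    the range of [h] is only dense; near-minimizers take its place. Errors are measured in the
    seminorm of [A + B], which dominates the forms of [A], [B] and [F] at once.

    The spectral data supply only the positive measures <E(.)x, x>. Products of operators are
    reached from them by polarization, arranged so that only sums of positive measures and
    nonnegative densities occur.

    Most estimates use the real part of the inner product and are stated for a real semidefinite
    form on an arbitrary module. The same lemmas then serve the Hilbert space, the forms of [A],
    [B], [F], and the n-fold sum on which square roots are extracted. *)

Section PsdForms.
Context {R : realType} {W : lmodType R[i]}.
Implicit Types (b : W -> W -> R) (x y z : W).

Record psd_form b : Prop := PsdForm {
  psdDl : forall x y z, b (x + y) z = b x z + b y z ;
  psdZl : forall r x y, b (r%:C *: x) y = r * b x y ;
  psdC : forall x y, b x y = b y x ;
  psd_ge0 : forall x, 0 <= b x x }.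

Variable b : W -> W -> R.
Hypothesis pb : psd_form b.

Lemma psdDr x y z : b z (x + y) = b z x + b z y.
Proof. by rewrite ![b z _]psdC// psdDl. Qed.

Lemma psdZr r x y : b y (r%:C *: x) = r * b y x.
Proof. by rewrite ![b y _]psdC// psdZl. Qed.

Lemma psdNl x y : b (- x) y = - b x y.
Proof.
have -> : - x = (-1 : R)%:C *: x by rewrite rmorphN scaleN1r.
by rewrite psdZl// mulN1r.
Qed.

Lemma psdNr x y : b y (- x) = - b y x.
Proof. by rewrite ![b y _]psdC// psdNl. Qed.

Lemma psd0l y : b 0 y = 0.
Proof.
have -> : 0 = (0 : R)%:C *: (0 : W) by rewrite scaler0.
by rewrite psdZl// mul0r.
Qed.

Definition psdE := (psdDl pb, psdDr, psdZl pb, psdZr, psdNl, psdNr).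

Lemma psd_CauchySchwarz x y : b x y ^+ 2 <= b x x * b y y.
Proof.
have key t : 0 <= t ^+ 2 * b x x + 2 * t * b x y + b y y.
  have := psd_ge0 pb (t%:C *: x + y); rewrite !psdE (psdC pb y x).
  by move=> /le_trans; apply; rewrite le_eqVlt; apply/orP; left; apply/eqP; ring.
have := psd_ge0 pb x; rewrite le_eqVlt => /orP[/eqP xx0|xx0].
  rewrite -xx0 mul0r; have [xy0|xy0] := eqVneq (b x y) 0.
    by rewrite xy0 expr0n.
  (* The quadratic in t is affine here, and this t gives it the value -1. *)
  have := key (- (b y y + 1) / (2 * b x y)); rewrite -xx0 mulr0 add0r.
  have -> : 2 * (- (b y y + 1) / (2 * b x y)) * b x y = - (b y y + 1).
    by field; rewrite xy0.
  by move=> h; exfalso; lra.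
have := key (- (b x y) / b x x).
have -> : (- b x y / b x x) ^+ 2 * b x x + 2 * (- b x y / b x x) * b x y + b y y
  = (b x x * b y y - b x y ^+ 2) / b x x by field; lra.
by rewrite pmulr_lge0 ?invr_gt0// subr_ge0.
Qed.

(** The gap between the two sides is b(t x - y, t x - y) / t. For small t this lets a perturbation y
    of small seminorm be absorbed at nearly no cost in x. *)
Lemma psd_weighted (t : R) x y : 0 < t ->
  b (x + y) (x + y) <= (1 + t) * b x x + (1 + t^-1) * b y y.
Proof.
move=> t0; have := psd_ge0 pb (t%:C *: x - y); rewrite !psdE (psdC pb y x) => h.
have e : (1 + t) * b x x + (1 + t^-1) * b y y - (b x x + b x y + (b x y + b y y))
  = t^-1 * (t * (t * b x x) + - (t * b x y) - (t * b x y + - b y y)).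
  by field; lra.
by rewrite -subr_ge0 e mulr_ge0 ?invr_ge0 ?(ltW t0).
Qed.

Definition psd_norm x : R := Num.sqrt (b x x).

Lemma psd_norm_ge0 x : 0 <= psd_norm x.
Proof. exact: sqrtr_ge0. Qed.

Lemma sqr_psd_norm x : psd_norm x ^+ 2 = b x x.
Proof. by rewrite sqr_sqrtr// psd_ge0. Qed.

Lemma psd_CauchySchwarz_norm x y : b x y <= psd_norm x * psd_norm y.
Proof.
apply: le_trans (ler_norm _) _; rewrite -ler_sqr ?nnegrE ?mulr_ge0 ?psd_norm_ge0//.
by rewrite real_normK ?num_real// exprMn !sqr_psd_norm psd_CauchySchwarz.
Qed.

Lemma psd_normD x y : psd_norm (x + y) <= psd_norm x + psd_norm y.
Proof.
rewrite -ler_sqr ?nnegrE ?addr_ge0 ?psd_norm_ge0// sqrrD !sqr_psd_norm.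
have := psd_CauchySchwarz_norm x y.
by rewrite !psdE (psdC pb y x); lra.
Qed.

Lemma psd_normZ r x : psd_norm (r%:C *: x) = `|r| * psd_norm x.
Proof.
by rewrite /psd_norm psdZl// psdZr mulrA -expr2 sqrtrM ?sqr_ge0// sqrtr_sqr.
Qed.

End PsdForms.

Section PsdOperators.
Context {R : realType} {W : lmodType R[i]}.
Variables (b : W -> W -> R).
Hypothesis pb : psd_form b.

Definition qform (T : W -> W) x y : R := b (T x) y.

(* Cauchy-Schwarz for the form of S at the vectors x and S x. *)
Lemma psd_op_sqr (S : W -> W) (c : R) : 0 <= c -> psd_form (qform S) ->
  (forall x, qform S x x <= c * b x x) ->
  forall x, b (S x) (S x) <= c * qform S x x.
Proof.
move=> c0 pS Sc x; have := psd_CauchySchwarz pS x (S x).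
rewrite /qform => cs; have := psd_ge0 pb (S x).
rewrite le_eqVlt => /orP[/eqP <-|SS]; first exact: mulr_ge0 (psd_ge0 pS x).
rewrite -(ler_pM2r SS) -expr2 (le_trans cs)// -mulrA mulrCA ler_wpM2l//.
  exact: psd_ge0 pS x.
exact: Sc.
Qed.

(* Iterating k |-> k - S k / c from u changes u by elements of the range of S
   only, and decreases |k|^2 by at least <S k, k> / c. *)
Lemma psd_op_range_approx (S : W -> W) (c : R) : 0 < c -> linear S ->
  psd_form (qform S) -> (forall x, qform S x x <= c * b x x) ->
  forall u (e : R), 0 < e -> exists w, qform S (u - S w) (u - S w) <= e.
Proof.
move=> c0 linS pS Sc u e e0; apply: contrapT => /forallNP noW.
have SC r x y : S (r%:C *: x + y) = r%:C *: S x + S y by exact: linS.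
have step n : exists w, b (u - S w) (u - S w) <= b u u - n%:R * (e / c).
  elim: n => [|n [w IH]].
    exists 0; have -> : S 0 = 0 by have := linS (-1) 0 0; rewrite !scaleN1r !addNr.
    by rewrite subr0 mul0r subr0.
  have /negP := noW w; rewrite -ltNge => ek.
  exists ((c^-1)%:C *: (u - S w) + w); move: ek IH; rewrite SC; set k := u - S w.
  have -> : u - ((c^-1)%:C *: S k + S w) = k - (c^-1)%:C *: S k.
    by rewrite opprD addrCA addrC.
  clearbody k => ek IH; rewrite !(psdE pb) (psdC pb k).
  have := psd_op_sqr (ltW c0) pS Sc k; rewrite -[b (S k) k]/(qform S k k) => SS.
  have h1 : c^-1 * (c^-1 * b (S k) (S k)) <= c^-1 * qform S k k.
    rewrite ler_pM2l ?invr_gt0// -(ler_pM2l c0) mulrA divff ?mul1r//; lra.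
  have h2 : e / c <= c^-1 * qform S k k by rewrite mulrC ler_pM2l ?invr_gt0// ltW.
  by rewrite -natr1 mulrDl mul1r; lra.
have [n _ hn] : exists2 n : nat, True & b u u < n%:R * (e / c).
  exists (Num.bound (b u u / (e / c))) => //.
  by rewrite -ltr_pdivrMr ?divr_gt0// archi_boundP// divr_ge0 ?psd_ge0 ?divr_ge0 ?ltW.
by have [w] := step n; have := psd_ge0 pb (u - S w); lra.
Qed.

End PsdOperators.

(** The square accounts for two successive uses of [psd_weighted]. As t <= 1, the excess ((1 + t)^2
    - 1) y is at most 3 t y, which the choice t = d / (3 (d + 2 y)) keeps below d / 2; the other
    half of d is left for e. *)
Lemma weight_approx (R : realType) (y d : R) : 0 <= y -> 0 < d ->
  exists t e : R, [/\ 0 < t, 0 < e & (1 + t) ^+ 2 * y + e <= y + d].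
Proof.
move=> y0 d0; set t := d / (3 * (d + 2 * y)).
have D0 : 0 < 3 * (d + 2 * y) by lra.
have t0 : 0 < t by rewrite divr_gt0.
have t1 : t <= 1 by rewrite ler_pdivrMr//; lra.
exists t, (d / 2); split=> //; first by lra.
have ty : t * (3 * (d + 2 * y)) = d by rewrite divfK// gt_eqF.
have tty : t * (t * y) <= t * y by rewrite -[leRHS]mul1r ler_wpM2r ?(mulr_ge0 (ltW t0)).
have td : 0 < t * d by rewrite mulr_gt0.
have -> : (1 + t) ^+ 2 * y = y + 2 * (t * y) + t * (t * y) by ring.
have : t * d * 3 + 6 * (t * y) = d by apply: etrans ty; ring.
lra.
Qed.

(** * The variational formula *)

Section AbstractParallelSum.
Context {R : realType} {W : lmodType R[i]}.
Variables (b : W -> W -> R) (A B F : W -> W) (c : R).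
Hypothesis pb : psd_form b.
Hypotheses (linA : linear A) (linB : linear B).
Hypotheses (pA : psd_form (qform b A)) (pB : psd_form (qform b B)).
Hypothesis pF : psd_form (qform b F).
Hypothesis c0 : 0 < c.
Hypothesis bound : forall x, qform b A x x + qform b B x x <= c * b x x.
Hypothesis AB : forall x, A (B x) = B (A x).
Hypothesis FleA : forall x, qform b F x x <= qform b A x x.
Hypothesis FS : forall x y, b (F (A x + B x)) y = b (A (B x)) y.

Let S x := A x + B x.
Let qA x := qform b A x x.
Let qB x := qform b B x x.
Let qF x := qform b F x x.
Let qS x := qform b S x x.

Let qSE x : qS x = qA x + qB x.
Proof. by rewrite /qS /qform /S (psdDl pb). Qed.

Let pS : psd_form (qform b S).
Proof.
have e x y : qform b S x y = qform b A x y + qform b B x y.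
  by rewrite /qform /S (psdDl pb).
split=> [x y z|r x y|x y|x]; rewrite !e.
- by rewrite (psdDl pA) (psdDl pB) addrACA.
- by rewrite (psdZl pA) (psdZl pB) mulrDr.
- by rewrite (psdC pA) (psdC pB).
- by rewrite addr_ge0// ?(psd_ge0 pA) ?(psd_ge0 pB).
Qed.

Let linS : linear S.
Proof. by move=> a x y; rewrite /S linA linB scalerDr addrACA. Qed.

(** Exact completion of the square for u = S w and v = B w + d. The cross terms <A B w, d> and <B A
    w, d> cancel by commutation, and F S = A B turns the constant terms into [qF (S w)]. *)
Let parallel_range w d :
  qA (B w + d) + qB (A w - d) = qF (S w) + qA d + qB d.
Proof.
have -> : qF (S w) = qA (B w) + qB (A w).
  by rewrite /qF /qform FS (psdDr pb) addrC; congr (_ + _); rewrite AB.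
rewrite /qA /qB !(psdE pA) !(psdE pB) (psdC pA d) (psdC pB d).
have -> : qform b A (B w) d = qform b B (A w) d by rewrite /qform AB.
ring.
Qed.

Let qk k t e : 0 < t -> qS k <= e / ((1 + t^-1) + (1 + t) * (1 + t^-1)) ->
  (1 + t^-1) * qS k + (1 + t) * ((1 + t^-1) * qS k) <= e.
Proof.
move=> t0; have ti : 0 < t^-1 by rewrite invr_gt0.
have p1 : 0 < (1 + t) * (1 + t^-1) by rewrite mulr_gt0//; lra.
rewrite ler_pdivlMr; last by lra.
by apply: le_trans; rewrite le_eqVlt; apply/orP; left; apply/eqP; ring.
Qed.

(** The left-hand side is the total error of two uses of [psd_weighted], the second of which is
    multiplied by 1 + t. *)
Let range_approx u t e : 0 < t -> 0 < e -> exists w,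
  (1 + t^-1) * qS (u - S w) + (1 + t) * ((1 + t^-1) * qS (u - S w)) <= e.
Proof.
move=> t0 e0; have ti : 0 < t^-1 by rewrite invr_gt0.
have p1 : 0 < (1 + t) * (1 + t^-1) by rewrite mulr_gt0//; lra.
have Sc x : qform b S x x <= c * b x x by rewrite -/(qS x) qSE; exact: bound.
have e'0 : 0 < e / ((1 + t^-1) + (1 + t) * (1 + t^-1)) by rewrite divr_gt0//; lra.
by have [w /(qk t0) ?] := psd_op_range_approx pb c0 linS pS Sc u e'0; exists w.
Qed.

Let weighted T (pT : psd_form (qform b T)) t x y : 0 < t ->
    (forall z, qform b T z z <= qS z) ->
  qform b T (x + y) (x + y) <= (1 + t) * qform b T x x + (1 + t^-1) * qS y.
Proof.
move=> t0 TS; apply: le_trans (psd_weighted pT _ _ t0) _.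
by rewrite lerD2l ler_wpM2l// addr_ge0// invr_ge0 ltW.
Qed.

Let qB_le x : qB x <= qS x.
Proof. by rewrite qSE lerDr (psd_ge0 pA). Qed.

Let qF_le x : qF x <= qS x.
Proof. by apply: le_trans (FleA _) _; rewrite qSE lerDl (psd_ge0 pB). Qed.

(* For u = S w, completing the square around v = B w gives the bound, with
   equality at v = B w; vectors at small S-seminorm from u are harmless. *)
Lemma parallel_lower u v : qF u <= qA v + qB (u - v).
Proof.
have y0 : 0 <= qA v + qB (u - v) by rewrite addr_ge0 ?(psd_ge0 pA) ?(psd_ge0 pB).
apply/ler_addgt0Pr => d d0; have [t [e [t0 e0 te]]] := weight_approx y0 d0.
apply: le_trans te; have [w] := range_approx u t0 e0; set k := u - S w => kw.
have h1 : qF u <= (1 + t) * qF (S w) + (1 + t^-1) * qS k.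
  by rewrite {1}(_ : u = S w + k); [exact: weighted|rewrite addrC subrK].
have h2 : qF (S w) <= qA v + qB (S w - v).
  have := parallel_range w (v - B w); rewrite (addrC (B w)) subrK opprB addrA -/(S w).
  by move=> ->; rewrite -addrA lerDl addr_ge0 ?(psd_ge0 pA) ?(psd_ge0 pB).
have h3 : qB (S w - v) <= (1 + t) * qB (u - v) + (1 + t^-1) * qS k.
  rewrite (_ : S w - v = (u - v) + - k); last first.
    by rewrite /k opprB [RHS]addrC addrA subrK.
  apply: le_trans (weighted pB _ _ t0 qB_le) _; rewrite lerD2l /qS.
  by rewrite (psdNl pS) (psdNr pS) opprK.
have t1 : 0 < 1 + t by lra.
have := h2; rewrite -(ler_pM2l t1) => h4.
have := h3; rewrite -(ler_pM2l t1) => h5.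
have h6 : (1 + t) * qA v <= (1 + t) ^+ 2 * qA v.
  by rewrite ler_wpM2r ?(psd_ge0 pA)//; rewrite expr2 -[leLHS]mulr1 ler_wpM2l//; lra.
move: h5 h4 h6 kw h1; rewrite !mulrDr expr2 -!mulrA; lra.
Qed.

Lemma parallel_upper u d : 0 < d -> exists v, qA v + qB (u - v) <= qF u + d.
Proof.
move=> d0; have u0 : 0 <= qF u := psd_ge0 pF u.
have [t [e [t0 e0 te]]] := weight_approx u0 d0.
have [w] := range_approx u t0 e0; set k := u - S w => kw; exists (B w).
apply: le_trans te.
have h1 : qB (u - B w) <= (1 + t) * qB (A w) + (1 + t^-1) * qS k.
  rewrite (_ : u - B w = A w + k); first exact: weighted.
  by rewrite /k /S opprD addrCA addNKr.
have h2 : qA (B w) + qB (A w) = qF (S w).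
  have := parallel_range w 0; rewrite addr0 subr0 => ->.
  by rewrite /qA /qB (psd0l pA) (psd0l pB) !addr0.
have h3 : qF (S w) <= (1 + t) * qF u + (1 + t^-1) * qS k.
  rewrite (_ : S w = u + - k); last by rewrite /k subKr.
  apply: le_trans (weighted pF _ _ t0 qF_le) _; rewrite lerD2l /qS.
  by rewrite (psdNl pS) (psdNr pS) opprK.
have t1 : 0 < 1 + t by lra.
have := h3; rewrite -(ler_pM2l t1) -h2 => h4.
have h6 : qA (B w) <= (1 + t) * qA (B w).
  by rewrite -[leLHS]mul1r ler_wpM2r ?(psd_ge0 pA)//; lra.
move: h1 h4 h6 kw; rewrite !mulrDr expr2 -!mulrA; lra.
Qed.

End AbstractParallelSum.

(** * Real inner product of a complex Hilbert space *)

Section LinearMaps.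
Context {K : nzRingType} {U V : lmodType K} (T : U -> V).
Hypothesis linT : linear T.

Lemma linear_op0 : T 0 = 0.
Proof. by have := linT (-1) 0 0; rewrite !scaleN1r !addNr. Qed.

Lemma linear_opD x y : T (x + y) = T x + T y.
Proof. by have := linT 1 x y; rewrite !scale1r. Qed.

Lemma linear_opZ a x : T (a *: x) = a *: T x.
Proof. by have := linT a x 0; rewrite linear_op0 !addr0. Qed.

Lemma linear_opN x : T (- x) = - T x.
Proof. by rewrite -scaleN1r linear_opZ scaleN1r. Qed.

Lemma linear_opB x y : T (x - y) = T x - T y.
Proof. by rewrite linear_opD linear_opN. Qed.

Lemma linear_op_sum (I : Type) (s : seq I) (f : I -> U) :
  T (\sum_(i <- s) f i) = \sum_(i <- s) T (f i).
Proof. exact: (big_morph T linear_opD linear_op0). Qed.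

End LinearMaps.

Section RealInnerProduct.
Context {R : realType}.
Implicit Types (u v : R[i]) (r : R).

Lemma ReD u v : Re (u + v) = Re u + Re v.
Proof. by case: u v => [? ?] [? ?]. Qed.

Lemma Re_sum (I : Type) (s : seq I) (f : I -> R[i]) :
  Re (\sum_(i <- s) f i) = \sum_(i <- s) Re (f i).
Proof. exact: (big_morph _ ReD). Qed.

Lemma ReZ r u : Re (r%:C * u) = r * Re u.
Proof. by case: u => [a c]; rewrite /= mul0r subr0. Qed.

Lemma complex_ge0E u : (0 <= u) = (Im u == 0) && (0 <= Re u).
Proof. by rewrite lecE. Qed.

(* A sesquilinear form that is real on the diagonal is hermitian; only its real
   part is recorded here. *)
Lemma sesquilinear_psd (W : lmodType R[i]) (f : W -> W -> R[i]) :
  (forall a x y z, f (a *: x + y) z = a * f x z + f y z) ->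
  (forall a x y z, f z (a *: x + y) = a^*%C * f z x + f z y) ->
  (forall x, 0 <= f x x) -> psd_form (fun x y => Re (f x y)).
Proof.
move=> fl fr f0; split=> [x y z|r x y|x y|x].
- by have := fl 1 x y z; rewrite scale1r mul1r => ->; rewrite ReD.
- have f0l : f 0 y = 0.
    by have := fl (-1) 0 0 y; rewrite scaleN1r addNr mulN1r addNr.
  by have := fl r%:C x 0 y; rewrite addr0 f0l addr0 => ->; rewrite ReZ.
- have im z : Im (f z z) = 0 by apply: ger0_Im.
  (* As the diagonal is real, the imaginary part of the value at i x + y is Re f(x, y) - Re f(y, x),
     up to sign. *)
  have := im ('i%C *: x + y); rewrite fl !fr.
  have := im x; have := im y.
  case: (f x x) (f y y) (f x y) (f y x)
    => a a' [b b'] [d d'] [e e'] /= -> -> h; move: h; lra.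
- by have := f0 x; rewrite complex_ge0E => /andP[].
Qed.

Definition rdot {H : hilbert R} (x y : H) : R := Re (dotp x y).

Definition hnrm {H : hilbert R} (x : H) : R := psd_norm rdot x.

Context {H : hilbert R}.
Implicit Types (x y z : H) (T : H -> H).

Lemma dotpDl x y z : dotp (x + y) z = dotp x z + dotp y z.
Proof. exact: linearDl. Qed.

Lemma dotpDr x y z : dotp z (x + y) = dotp z x + dotp z y.
Proof. exact: linearDr. Qed.

Lemma dotpZl (a : R[i]) x y : dotp (a *: x) y = a * dotp x y.
Proof. exact: linearZl_LR. Qed.

Lemma dotpZr (a : R[i]) x y : dotp y (a *: x) = a^*%C * dotp y x.
Proof. exact: linearZr_LR. Qed.

Lemma dotp_suml (I : Type) (s : seq I) (f : I -> H) y :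
  dotp (\sum_(i <- s) f i) y = \sum_(i <- s) dotp (f i) y.
Proof. by apply: (big_morph (dotp^~ y)) => [? ?|]; [exact: dotpDl|exact: linear0l]. Qed.

Lemma dotp_sumr (I : Type) (s : seq I) (f : I -> H) y :
  dotp y (\sum_(i <- s) f i) = \sum_(i <- s) dotp y (f i).
Proof. by apply: (big_morph (dotp y)) => [? ?|]; [exact: dotpDr|exact: linear0r]. Qed.

Lemma dotpC x y : dotp x y = (dotp y x)^*%C.
Proof. by rewrite /dotp hermC /= expr0 mul1r. Qed.

Lemma dotp_ge0 x : 0 <= dotp x x.
Proof. by rewrite /dotp hdotE exprn_ge0. Qed.

Lemma rdot_psd : psd_form (@rdot H).
Proof.
split=> [x y z|r x y|x y|x]; rewrite /rdot.
- by rewrite dotpDl ReD.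
- by rewrite dotpZl ReZ.
- by rewrite dotpC; case: (dotp y x).
- by have := dotp_ge0 x; rewrite complex_ge0E => /andP[].
Qed.

Lemma rdot_ext x y : (forall z, rdot z x = rdot z y) -> x = y.
Proof.
move=> xy; apply: dotp_ext => z; apply/eqP; rewrite eq_complex; apply/andP; split.
  exact/eqP/xy.
have := xy ('i%C *: z); rewrite /rdot !dotpZl.
by case: (dotp z x) (dotp z y) => a c [a' c'] /=; rewrite !mul0r !mul1r => h;
  apply/eqP; lra.
Qed.

Lemma normE x : `|x| = (hnrm x)%:C.
Proof.
apply/eqP; rewrite -(eqrXn2 (n := 2))//; last by rewrite ler0c psd_norm_ge0.
rewrite -rmorphXn /= (sqr_psd_norm rdot_psd) -hdotE -/(dotp x x) /rdot.
by have := dotp_ge0 x; case: (dotp x x) => a c; rewrite complex_ge0E /= => /andP[/eqP ->].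
Qed.

Lemma rdot_eq0 x : rdot x x = 0 -> x = 0.
Proof. by move=> h; apply/eqP; rewrite -normr_eq0 normE /hnrm /psd_norm h sqrtr0. Qed.

Lemma boundedop_hnrm T : boundedop T ->
  exists2 c : R, 0 < c & forall x, hnrm (T x) <= c * hnrm x.
Proof.
move=> [linT ctsT]; pose f : {linear H -> H} := HB.pack T (GRing.isLinear.Build _ _ _ _ T linT).
have /linear_boundedP : bounded_near f (nbhs (0 : H)).
  by apply/linear_bounded_continuous; exact: ctsT.
move=> /pinfty_ex_gt0 [[c c'] c0 Tc]; exists c.
  by move: c0; rewrite ltcE => /andP[].
move=> x; have := Tc x; rewrite /= !normE lecE => /andP[_] /=.
by rewrite mulr0 subr0.
Qed.

Lemma boundedop_qform T : boundedop T ->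
  exists2 c : R, 0 < c & forall x, qform rdot T x x <= c * rdot x x.
Proof.
move=> /boundedop_hnrm[c c0 Tc]; exists c => // x.
apply: le_trans (psd_CauchySchwarz_norm rdot_psd _ _) _.
by rewrite -(sqr_psd_norm rdot_psd x) expr2 mulrA ler_wpM2r ?psd_norm_ge0//; exact: Tc.
Qed.

Lemma psd_qform T : linear T -> (forall x, 0 <= dotp (T x) x) ->
  psd_form (qform rdot T).
Proof.
move=> linT; apply: (sesquilinear_psd (f := fun x y => dotp (T x) y)) => [a x y z|a x y z].
- by rewrite linT dotpPl.
- exact: dotpPr.
Qed.

Lemma posop_psd T : posop T -> psd_form (qform rdot T).
Proof. by move=> [[linT _]]; exact: psd_qform. Qed.

End RealInnerProduct.

(** * Spectral calculus *)

Section Density.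
Context d (T : measurableType d) (R : realType).
Variables (m1 m2 m : {measure set T -> \bar R}) (g : T -> R).
Hypotheses (mg : measurable_fun setT (EFin \o g)) (g0 : forall x, 0 <= g x).
Hypothesis m1E : forall A, measurable A ->
  m1 A = (m2 A + \int[m]_(x in A) (g x)%:E)%E.

Import HBNNSimple.
Local Open Scope ereal_scope.

Let density_nnsfun (h : {nnsfun T >-> R}) :
  \int[m1]_x (h x)%:E = \int[m2]_x (h x)%:E + \int[m]_x ((h x)%:E * (g x)%:E).
Proof.
have -> : \int[m]_x ((h x)%:E * (g x)%:E) =
    \sum_(r \in range h) r%:E * \int[m]_(x in h @^-1` [set r]) (g x)%:E.
  transitivity (\int[m]_x \sum_(r \in range h)
      ((r * \1_(h @^-1` [set r]) x)%:E * (g x)%:E)).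
    apply: eq_integral => x _; rewrite -ge0_mule_fsuml => [|r]; last first.
      exact: nnfun_muleindic_ge0.
    by rewrite fsumEFin// -fimfunE.
  rewrite ge0_integral_fsum//; last 2 first.
  - move=> r; apply: emeasurable_funM => //; apply/measurable_EFinP.
    exact: measurable_funM.
  - by move=> r x _; apply: mule_ge0; [exact: nnfun_muleindic_ge0|rewrite lee_fin].
  apply: eq_fsbigr => r; rewrite inE => -[y _ <-].
  under eq_integral do rewrite EFinM -muleA.
  rewrite ge0_integralZl//; last 3 first.
  - by apply: emeasurable_funM => //; exact/measurable_EFinP.
  - by move=> x _; rewrite mule_ge0// ?lee_fin.
  - by rewrite lee_fin.
  congr (_ * _); rewrite -[in RHS](setTI (h @^-1` _)) integral_mkcondr.
  by apply: eq_integral => x _; rewrite epatch_indic/= muleC.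
rewrite !integralT_nnsfun !sintegralE -fsbig_split//=.
apply: eq_fsbigr => r; rewrite inE => -[y _ <-].
by rewrite m1E// ge0_muleDr//; apply: integral_ge0 => ? _; rewrite lee_fin.
Qed.

(** Simple functions and monotone convergence extend the identity m1 = m2 + g m from sets to
    functions. Its shape is that of a polarization identity with the negative measure moved to the
    other side, so signed measures never appear. *)
Lemma ge0_integral_density (k : T -> \bar R) : measurable_fun setT k ->
  (forall x, 0 <= k x) ->
  \int[m1]_x k x = \int[m2]_x k x + \int[m]_x (k x * (g x)%:E).
Proof.
move=> mk k0; pose h := nnsfun_approx measurableT mk.
have hk x : (h n x)%:E @[n --> \oo] --> k x by exact: cvg_nnsfun_approx.
have hnd x a b : (a <= b)%N -> (h a x)%:E <= (h b x)%:E.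
  by move=> ab; rewrite lee_fin; exact/lefP/nd_nnsfun_approx.
have cvgk (m' : {measure set T -> \bar R}) :
    \int[m']_x (h n x)%:E @[n --> \oo] --> \int[m']_x k x.
  have -> : \int[m']_x k x = \int[m']_x limn (fun n => (h n x)%:E).
    by apply: eq_integral => x _; apply/esym/cvg_lim => //; exact: hk.
  apply: (@cvg_monotone_convergence _ _ _ m' _ measurableT (fun n x => (h n x)%:E)) => //.
  - by move=> n; exact/measurable_EFinP.
  - by move=> n x _; rewrite lee_fin.
  - by move=> x _ a b; exact: hnd.
have cvgkg : \int[m]_x ((h n x)%:E * (g x)%:E) @[n --> \oo] --> \int[m]_x (k x * (g x)%:E).
  have -> : \int[m]_x (k x * (g x)%:E) = \int[m]_x limn (fun n => (h n x)%:E * (g x)%:E).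
    apply: eq_integral => x _; apply/esym/cvg_lim => //.
    by apply: cvgeZr => //; exact: hk.
  apply: (@cvg_monotone_convergence _ _ _ m _ measurableT (fun n x => (h n x)%:E * (g x)%:E)) => //.
  - by move=> n; apply: emeasurable_funM => //; exact/measurable_EFinP.
  - by move=> n x _; rewrite mule_ge0// ?lee_fin.
  - by move=> x _ a b ab; apply: lee_wpmul2r; rewrite ?lee_fin//; exact: hnd.
rewrite -(cvg_lim _ (cvgk m1))//; apply/cvg_lim => //.
have -> : (fun n => \int[m1]_x (h n x)%:E) =
    (fun n => \int[m2]_x (h n x)%:E + \int[m]_x ((h n x)%:E * (g x)%:E)).
  by apply/funext => n; exact: density_nnsfun.
apply: cvgeD => //; apply: ge0_adde_def; rewrite inE integral_ge0//.
by move=> x _; rewrite mule_ge0 ?lee_fin.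
Qed.

End Density.

Lemma EFin_addI (R : realType) (a c : R) (I : \bar R) :
  (a + c)%:E = (a%:E + I)%E -> c%:E = I.
Proof. by case: I => [r [/addrI ->]|//|//]. Qed.

Section SpectralCalculus.
Context {R : realType} {H : hilbert R}.
Variables (A B : H -> H) (E : set (R * R) -> H -> H).
Variable mu : H -> {measure set (R * R) -> \bar R}.
Hypothesis JSM : joint_spectral_measure A B E mu.
Implicit Types (x y : H) (S T : set (R * R)) (k g : R * R -> R).
Local Notation quadrant := [set z : R * R | 0 <= z.1 /\ 0 <= z.2].

Let linE S : measurable S -> linear (E S).
Proof. by move=> /(jsm_bounded JSM)[]. Qed.

Let E_sym S x y : measurable S -> rdot (E S x) y = rdot x (E S y).
Proof. by move=> mS; rewrite /rdot (jsm_selfadjoint JSM mS). Qed.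

Let E_I S T x : measurable S -> measurable T -> E S (E T x) = E (S `&` T) x.
Proof. by move=> mS mT; rewrite (jsm_setI JSM mS mT). Qed.

Let muE x S : measurable S -> mu x S = (rdot (E S x) x)%:E.
Proof. exact: jsm_measure JSM x S. Qed.

Let E_null S : measurable S -> (forall x, mu x S = 0%E) -> E S = cst 0.
Proof.
move=> mS h; apply/funext => x; apply: rdot_eq0.
by have := h x; rewrite muE// => -[Sx]; rewrite /= -E_sym// E_I// setIid.
Qed.

Let E0 : E set0 = cst 0.
Proof. by apply: E_null => // x; rewrite measure0. Qed.

(** Additivity of E comes from that of the scalar measures: the defect y is killed by both
    projections, so the total mass of [mu y], which is <y, y>, vanishes. *)
Let EC S x : measurable S -> x = E S x + E (~` S) x.
Proof.
move=> mS; have mC := measurableC mS.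
apply/eqP; rewrite -subr_eq0; apply/eqP/rdot_eq0; set y := x - _.
have yS : E S y = 0.
  rewrite /y (linear_opD (linE mS)) (linear_opN (linE mS)).
  by rewrite (linear_opD (linE mS)) !E_I// setIid setICr E0 addr0 subrr.
have yC : E (~` S) y = 0.
  rewrite /y (linear_opD (linE mC)) (linear_opN (linE mC)).
  by rewrite (linear_opD (linE mC)) !E_I// setIid setICl E0 add0r subrr.
have : (mu y (S `|` ~` S) = mu y S + mu y (~` S))%E.
  by apply: measureU => //; exact: setICr.
rewrite setUv !muE// yS yC.
by rewrite (jsm_setT JSM) /= (psd0l rdot_psd) adde0 => -[].
Qed.

Let muI x S T : measurable S -> measurable T -> mu (E T x) S = mu x (S `&` T).
Proof.
move=> mS mT; have mST := measurableI _ _ mS mT.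
rewrite !muE// -E_sym// E_I// E_I//; last exact: measurableI.
by rewrite setIAC setIid setIC.
Qed.

Let cross_mu x y S T T' : measurable S -> measurable T -> measurable T' ->
  T `&` T' = set0 ->
  mu (E T x + E T' y) S = (mu (E T x) S + mu (E T' y) S)%E.
Proof.
move=> mS mT mT' TT'; rewrite !muE// -EFinD; congr (_%:E).
rewrite (linear_opD (linE mS)) !(psdE rdot_psd).
have -> : rdot (E S (E T' y)) (E T x) = rdot (E S (E T x)) (E T' y).
  by rewrite E_sym// (psdC rdot_psd).
have -> : rdot (E S (E T x)) (E T' y) = 0.
  rewrite -E_sym// E_I// E_I//; last exact: measurableI.
  by rewrite setIAC (setIC T') TT' set0I E0 /= (psd0l rdot_psd).
ring.
Qed.

(** K is the integral of k in the sense of quadratic forms. With k nonnegative everywhere, all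
    integrals exist in the extended reals, and the left-hand side makes this one finite. *)
Record calculus_op (K : H -> H) k : Prop := CalculusOp {
  cop_linear : linear K ;
  cop_psd : psd_form (qform rdot K) ;
  cop_ge0 : forall z, 0 <= k z ;
  cop_measurable : measurable_fun setT k ;
  cop_int : forall x, (qform rdot K x x)%:E = (\int[mu x]_z (k z)%:E)%E }.

Section Operator.
Variables (K : H -> H) (k : R * R -> R).
Hypothesis Kk : calculus_op K k.

Let pK := cop_psd Kk.
Let linK := cop_linear Kk.

Let mk : measurable_fun setT (EFin \o k).
Proof. by apply/measurable_EFinP; exact: cop_measurable Kk. Qed.

Let k0 z : (0 <= (k z)%:E)%E.
Proof. by rewrite lee_fin; exact: cop_ge0 Kk z. Qed.

(** Orthogonality of disjoint spectral subspaces makes the scalar measures add up at a + c. The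
    quadratic form of K is then additive there, so its cross term is zero. *)
Let cross x y T T' : measurable T -> measurable T' -> T `&` T' = set0 ->
  rdot (K (E T x)) (E T' y) = 0.
Proof.
move=> mT mT' TT'; set a := E T x; set c := E T' y.
have : qform rdot K (a + c) (a + c) = qform rdot K a a + qform rdot K c c.
  apply: EFin_inj; rewrite EFinD !(cop_int Kk) -ge0_integral_measure_add//.
  apply: eq_measure_integral => S mS _.
  by apply: etrans (esym (measure_addE _ _ _)); exact: cross_mu.
rewrite !(psdE pK) (psdC pK c a) /qform; lra.
Qed.

Lemma spectral_commute x y T : measurable T ->
  rdot (E T (K x)) y = rdot (K (E T x)) (E T y).
Proof.
move=> mT; have mC := measurableC mT; rewrite E_sym// {1}(EC x mT).
by rewrite (linear_opD linK) (psdDl rdot_psd) [X in _ + X]cross ?addr0// setICl.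
Qed.

Lemma spectral_restrict x T : measurable T ->
  (rdot (E T (K x)) x)%:E = (\int[mu x]_(z in T) (k z)%:E)%E.
Proof.
move=> mT; rewrite spectral_commute// -/(qform rdot K _ _) (cop_int Kk).
rewrite (@ge0_integral_density _ _ _ (mu (E T x)) mzero (mu x) \1_T)//.
- rewrite integral_measure_zero add0e -[in RHS](setTI T) integral_mkcondr.
  by apply: eq_integral => z _; rewrite epatch_indic.
- exact/measurable_EFinP.
- by move=> S mS; rewrite muI// /mzero add0e integral_indic// setIC.
Qed.

End Operator.

Section Product.
Variables (K G : H -> H) (k g : R * R -> R).
Hypotheses (Kk : calculus_op K k) (Gg : calculus_op G g).

Let pK := cop_psd Kk.

Let mu_pm x y (e : R) T : measurable T -> e ^+ 2 = 1 ->
  mu (G x + e%:C *: y) T =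
  (rdot (E T (G x)) (G x) + rdot (E T y) y + 2 * e * rdot (E T (G x)) y)%:E.
Proof.
move=> mT e1; rewrite muE//; congr (_%:E).
rewrite (linear_opD (linE mT)) (linear_opZ (linE mT)) !(psdE rdot_psd).
rewrite [rdot (E T y) (G x)]E_sym// (psdC rdot_psd y) mulrA -expr2 e1.
ring.
Qed.

Let mu_p x y T : measurable T -> mu (G x + y) T =
  (rdot (E T (G x)) (G x) + rdot (E T y) y + 2 * rdot (E T (G x)) y)%:E.
Proof.
by move=> mT; have := mu_pm x y mT (expr1n _ 2); rewrite scale1r mulr1.
Qed.

Let mu_m x y T : measurable T -> mu (G x - y) T =
  (rdot (E T (G x)) (G x) + rdot (E T y) y - 2 * rdot (E T (G x)) y)%:E.
Proof.
move=> mT; have := mu_pm x y mT (sqrr_sign _ 1).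
by rewrite expr1 rmorphN scaleN1r mulrN1 mulNr.
Qed.

Let polar x y :
  qform rdot K (x + y) (x + y) = qform rdot K (x - y) (x - y) + 4 * rdot (K x) y.
Proof. by rewrite !(psdE pK) (psdC pK y x) /qform; ring. Qed.

Let mK : measurable_fun setT (EFin \o k).
Proof. by apply/measurable_EFinP; exact: cop_measurable Kk. Qed.

Let k0 z : (0 <= (k z)%:E)%E.
Proof. by rewrite lee_fin; exact: cop_ge0 Kk z. Qed.

(** Polarization gives [mu (G x + x) = mu (G x - x) + 4 g mu x] as measures, by [spectral_restrict]
    for G. Integrating k against both sides, the left minus the first term on the right is 4 <K G x,
    x>. *)
Lemma spectral_product x :
  (4 * rdot (K (G x)) x)%:E = (\int[mu x]_z (k z * (4 * g z))%R%:E)%E.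
Proof.
have dens : (\int[mu (G x + x)%R]_z (k z)%:E =
    \int[mu (G x - x)%R]_z (k z)%:E + \int[mu x]_z ((k z)%:E * (4 * g z)%:E))%E.
  apply: (@ge0_integral_density _ _ _ _ _ _ (fun z => 4 * g z)) => //.
  - apply/measurable_EFinP; apply: measurable_funM => //.
    exact: cop_measurable Gg.
  - by move=> z; rewrite mulr_ge0// (cop_ge0 Gg).
  - move=> T mT; under eq_integral do rewrite EFinM.
    rewrite ge0_integralZl//; last first.
    + by move=> z _; rewrite lee_fin (cop_ge0 Gg).
    + by apply/measurable_EFinP/measurable_funTS; exact: cop_measurable Gg.
    rewrite -(spectral_restrict Gg)// -EFinM.
    by rewrite mu_p// mu_m// -EFinD; congr (_%:E); ring.
move: dens; rewrite -!(cop_int Kk) polar.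
under eq_integral do rewrite -EFinM.
exact: EFin_addI.
Qed.

(** The forms <E(T) G x, y> are symmetric in x and y, so [mu (G x + y) + mu (G y - x)] and
    [mu (G y + x) + mu (G x - y)] are the same measure. Integrating k and polarizing compares the
    two cross terms. *)
Lemma spectral_product_sym x y : rdot (K (G x)) y = rdot (K (G y)) x.
Proof.
have h T : measurable T -> rdot (E T (G x)) y = rdot (E T (G y)) x.
  move=> mT; rewrite !(spectral_commute Gg)//.
  exact: (psdC (cop_psd Gg)).
have : (qform rdot K (G x + y) (G x + y) + qform rdot K (G y - x) (G y - x))%:E =
       (qform rdot K (G y + x) (G y + x) + qform rdot K (G x - y) (G x - y))%:E.
  rewrite !EFinD !(cop_int Kk) -!ge0_integral_measure_add//.
  apply: eq_measure_integral => T mT _.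
  apply: etrans (measure_addE _ _ _) _; apply: etrans (esym (measure_addE _ _ _)).
  rewrite /= !mu_m// !mu_p// -!EFinD; congr (_%:E); rewrite h//; ring.
by move=> []; rewrite (polar (G x) y) (polar (G y) x); lra.
Qed.

End Product.

End SpectralCalculus.

Lemma dense_hnrm (R : realType) (H : hilbert R) (S : set H) (v : H) (d : R) :
  dense S -> 0 < d -> exists2 w, S w & rdot (w - v) (w - v) <= d.
Proof.
move=> dS d0; have e0 : 0 < (Num.sqrt d)%:C by rewrite ltcR sqrtr_gt0.
have [|w [vw Sw]] := dS (ball v (Num.sqrt d)%:C) _ (ball_open _ _).
  by exists v; exact: (ballxx _ e0).
exists w => //; move: vw; rewrite -ball_normE /= distrC normE ltcR => /ltW.
rewrite -ler_sqr ?nnegrE ?sqrtr_ge0 ?psd_norm_ge0// (sqr_sqrtr (ltW d0)).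
by rewrite (sqr_psd_norm rdot_psd).
Qed.

(** * Parallel sum of two commuting positive operators *)

Section ParallelCalculus.
Context {R : realType} {H : hilbert R}.
Local Notation quadrant := [set z : R * R | 0 <= z.1 /\ 0 <= z.2].

Let mquadrant : measurable quadrant.
Proof.
have -> : quadrant = (fst @^-1` `[0, +oo[) `&` (snd @^-1` `[0, +oo[).
  by apply/seteqP; split=> z /=; rewrite !in_itv/= !andbT.
apply: measurableI; rewrite -[_ @^-1` _]setTI.
- exact: measurable_fst.
- exact: measurable_snd.
Qed.

(** The spectral measure is carried by the quadrant, so f may be replaced by any measurable
    nonnegative function that agrees with it there. This lets absolute values replace the
    coordinates below. *)
Lemma calculus_op_quadrant (A B : H -> H) E mu (K : H -> H) (f k : R * R -> R) :
  joint_spectral_measure A B E mu -> linear K ->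
  (forall x, (mu x).-integrable setT (EFin \o f) /\
     dotp (K x) x = (\int[mu x]_z f z)%R%:C) ->
  (forall z, 0 <= k z) -> measurable_fun setT k ->
  (forall z, quadrant z -> f z = k z) ->
  calculus_op mu K k.
Proof.
move=> JSM linK Kf k0 mk fk.
have mCQ := measurableC mquadrant.
have muCQ x : mu x (~` quadrant) = 0%E.
  have EQ : E (~` quadrant) = E set0.
    rewrite -(setICr quadrant) (jsm_setI JSM mquadrant mCQ).
    by rewrite (jsm_quadrant JSM).
  by rewrite (jsm_measure JSM) // EQ -(jsm_measure JSM) //.
have int x : (Re (dotp (K x) x))%:E = (\int[mu x]_z (k z)%:E)%E.
  have [intf ->] := Kf x; rewrite /= /Rintegral fineK; last first.
    exact: integrable_fin_num.
  apply: ae_eq_integral => //; first exact: measurable_int intf.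
    exact/measurable_EFinP.
  exists (~` quadrant); split=> // z /= nfk Qz; apply: nfk => _.
  by rewrite /= fk.
split=> //; apply: psd_qform => // x.
have [_ ->] := Kf x; rewrite ler0c -lee_fin.
have := int x; have [_ ->] := Kf x => /= ->.
by apply: integral_ge0 => z _; rewrite lee_fin.
Qed.

Variables (A B F : H -> H).
Hypotheses (posA : posop A) (posB : posop B).
Hypothesis calcF : is_calculus parallel_fun A B F.

Let c1 (z : R * R) := `|z.1|.
Let c2 (z : R * R) := `|z.2|.
Let cf (z : R * R) := c1 z * c2 z / (c1 z + c2 z).

Let c10 z : 0 <= c1 z. Proof. exact: normr_ge0. Qed.
Let c20 z : 0 <= c2 z. Proof. exact: normr_ge0. Qed.
Let cf0 z : 0 <= cf z.
Proof. by rewrite divr_ge0 ?addr_ge0 ?mulr_ge0. Qed.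

Let mc1 : measurable_fun setT c1.
Proof. by apply: measurableT_comp => //; exact: measurable_fst. Qed.

Let mc2 : measurable_fun setT c2.
Proof. by apply: measurableT_comp => //; exact: measurable_snd. Qed.

Let cfS z : cf z * (4 * c1 z) + cf z * (4 * c2 z) = c1 z * (4 * c2 z).
Proof.
rewrite -mulrDr -mulrDr /cf; have [s0|s0] := eqVneq (c1 z + c2 z) 0.
  have := c10 z; have := c20 z; move=> h1 h2.
  have -> : c1 z = 0 by lra.
  by rewrite !mul0r.
by field.
Qed.

Let cf_le z : cf z <= c1 z.
Proof.
rewrite /cf; have [s0|s0] := eqVneq (c1 z + c2 z) 0.
  by rewrite s0 invr0 mulr0.
have s1 : 0 < c1 z + c2 z by rewrite lt_neqAle eq_sym s0 addr_ge0.
by rewrite ler_pdivrMr// ler_wpM2l// lerDr.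
Qed.

(* The last clause says F (A + B) = A B: both sides are symmetric and have the
   quadratic form given by r s = f(r, s) (r + s), so they coincide. *)
Lemma parallel_calculus :
  [/\ linear F, psd_form (qform rdot F), forall x, 0 <= dotp (F x) x,
      forall x, qform rdot F x x <= qform rdot A x x &
      forall x y, rdot (F (A x + B x)) y = rdot (A (B x)) y].
Proof.
have [E [mu [JSM [linF _] Ff]]] := calcF.
have [[linA _] _] := posA; have [[linB _] _] := posB.
(* Measurability of [parallel_fun] is read off its integrability clause, taken at the vector 0; [cf]
   is its composite with the absolute values of the coordinates. *)
have mcf : measurable_fun setT cf.
  apply: (measurableT_comp (f := parallel_fun) (g := fun z => (c1 z, c2 z))).
    by apply/measurable_EFinP; have [/measurable_int] := Ff 0.
  exact: measurable_fun_pair.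
have cA : calculus_op mu A c1.
  apply: (calculus_op_quadrant JSM linA (jsm_fst JSM)) => // z [z1 _].
  by rewrite /c1 ger0_norm.
have cB : calculus_op mu B c2.
  apply: (calculus_op_quadrant JSM linB (jsm_snd JSM)) => // z [_ z2].
  by rewrite /c2 ger0_norm.
have cF : calculus_op mu F cf.
  apply: (calculus_op_quadrant JSM linF Ff) => //.
  by move=> z [z1 z2]; rewrite /cf /c1 /c2 !ger0_norm.
split=> //.
- exact: cop_psd cF.
- move=> x; have := psd_ge0 (cop_psd cF) x; rewrite /qform /rdot.
  by have [_ ->] := Ff x; rewrite ler0c.
- move=> x; rewrite -lee_fin (cop_int cF) (cop_int cA).
  apply: ge0_le_integral => //.
  + by move=> z _; rewrite lee_fin.
  + by apply/measurable_EFinP; exact: cop_measurable cF.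
  + exact/measurable_EFinP.
  + by move=> z _; rewrite lee_fin.
pose D x y := rdot (F (A x + B x)) y - rdot (A (B x)) y.
have DE x y : D x y = rdot (F (A x)) y + rdot (F (B x)) y - rdot (A (B x)) y.
  by rewrite /D (linear_opD linF) (psdDl rdot_psd).
have Dsym x y : D x y = D y x.
  rewrite !DE (spectral_product_sym JSM cF cA x) (spectral_product_sym JSM cF cB x).
  by rewrite (spectral_product_sym JSM cA cB x).
have D0 x : D x x = 0.
  have : (4 * rdot (F (A x)) x + 4 * rdot (F (B x)) x)%:E
       = (4 * rdot (A (B x)) x)%:E.
    rewrite EFinD (spectral_product JSM cF cA) (spectral_product JSM cF cB).
    rewrite (spectral_product JSM cA cB) -ge0_integralD//.
    - by apply: eq_integral => z _; rewrite -EFinD cfS.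
    - by move=> z _; rewrite lee_fin; apply: mulr_ge0 => //; exact: mulr_ge0.
    - by apply/measurable_EFinP; apply: measurable_funM => //; exact: measurable_funM.
    - by move=> z _; rewrite lee_fin; apply: mulr_ge0 => //; exact: mulr_ge0.
    - by apply/measurable_EFinP; apply: measurable_funM => //; exact: measurable_funM.
  by rewrite DE => -[]; lra.
move=> x y; apply/eqP; rewrite -subr_eq0 -/(D x y); apply/eqP.
have : D (x + y) (x + y) = 0 by [].
have Dl x' y' z : D (x' + y') z = D x' z + D y' z.
  rewrite !DE !(linear_opD linA) !(linear_opD linB) !(linear_opD linF).
  by rewrite !(linear_opD linA) !(psdDl rdot_psd); ring.
by rewrite Dl !(Dsym _ (x + y)) !Dl !D0 (Dsym y x); lra.
Qed.

End ParallelCalculus.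

(** * Parallel sum of forms as an infimum *)

Section ParallelForm.
Context {R : realType} {V : lmodType R[i]}.
Variables (alpha beta gamma : V -> V -> R[i]).
Hypothesis par : is_form_parallel alpha beta gamma.

Lemma form_parallel_ge0 x : 0 <= gamma x x.
Proof.
have [H [h [A [B [F [[_ _ pA pB AB _ _] cF ->]]]]]] := par.
by have [_ _ + _ _] := parallel_calculus pA pB cF.
Qed.

(** Additivity of [gamma] is inherited from the linearity of [h] and [F] in a representation. *)
Lemma form_parallel_sum (I J : Type) (r : seq I) (s : seq J) (f : I -> V) (g : J -> V) :
  gamma (\sum_(i <- r) f i) (\sum_(j <- s) g j) =
  \sum_(i <- r) \sum_(j <- s) gamma (f i) (g j).
Proof.
have [H [h [A [B [F [[linh _ pA pB AB _ _] cF gE]]]]]] := par.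
have [linF _ _ _ _] := parallel_calculus pA pB cF.
rewrite gE !(linear_op_sum linh) (linear_op_sum linF) dotp_suml.
by apply: eq_bigr => i _; rewrite dotp_sumr; apply: eq_bigr => j _; rewrite gE.
Qed.

Lemma form_parallel_lower x y :
  Re (gamma x x) <= Re (alpha y y) + Re (beta (x - y) (x - y)).
Proof.
have [H [h [A [B [F [[linh _ pA pB AB aE bE] cF gE]]]]]] := par.
have [linF pF _ FA FS] := parallel_calculus pA pB cF.
have [cA cA0 hA] := boundedop_qform pA.1; have [cB cB0 hB] := boundedop_qform pB.1.
have bound z : qform rdot A z z + qform rdot B z z <= (cA + cB) * rdot z z.
  by rewrite mulrDl lerD.
have ABx z : A (B z) = B (A z) by rewrite -[LHS]/((A \o B) z) AB.
rewrite gE aE bE (linear_opB linh).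
exact: (parallel_lower rdot_psd pA.1.1 pB.1.1 (posop_psd pA) (posop_psd pB)
  pF (addr_gt0 cA0 cB0) bound ABx FA FS).
Qed.

(** The near-minimizer v lies in the Hilbert space, while y must come from V. Half of d pays for v,
    the other half for moving v to some [h y] by density; boundedness of [A] and [B] controls the
    effect on both forms. *)
Lemma form_parallel_upper x d : 0 < d ->
  exists y, Re (alpha y y) + Re (beta (x - y) (x - y)) <= Re (gamma x x) + d.
Proof.
move=> d0; have d20 : 0 < d / 2 by lra.
have [H [h [A [B [F [[linh dh pA pB AB aE bE] cF gE]]]]]] := par.
have [linF pF _ FA FS] := parallel_calculus pA pB cF.
have [cA cA0 hA] := boundedop_qform pA.1; have [cB cB0 hB] := boundedop_qform pB.1.
have bound z : qform rdot A z z + qform rdot B z z <= (cA + cB) * rdot z z.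
  by rewrite mulrDl lerD.
have ABx z : A (B z) = B (A z) by rewrite -[LHS]/((A \o B) z) AB.
have [v vx] := parallel_upper rdot_psd pA.1.1 pB.1.1 (posop_psd pA) (posop_psd pB)
  pF (addr_gt0 cA0 cB0) bound ABx FA FS (h x) d20.
have y0 : 0 <= qform rdot A v v + qform rdot B (h x - v) (h x - v).
  by rewrite addr_ge0// ?(psd_ge0 (posop_psd pA)) ?(psd_ge0 (posop_psd pB)).
have [t [e [t0 e0 te]]] := weight_approx y0 d20.
have t1 : 0 < 1 + t^-1 by rewrite addr_gt0// invr_gt0.
have c0 : 0 < (1 + t^-1) * (cA + cB) by rewrite mulr_gt0// addr_gt0.
have [_ [y _ <-] yv] := dense_hnrm v dh (divr_gt0 e0 c0).
exists y; rewrite gE aE bE.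
have -> : h (x - y) = h x - v + (v - h y).
  by rewrite addrA subrK (linear_opB linh).
have := psd_weighted (posop_psd pB) (h x - v) (v - h y) t0.
have := psd_weighted (posop_psd pA) v (h y - v) t0.
rewrite (addrC v (h y - v)) subrK.
have : (1 + t^-1) * (qform rdot A (h y - v) (h y - v) + qform rdot B (v - h y) (v - h y)) <= e.
  rewrite -[v - h y]opprB (psdNl (posop_psd pB)) (psdNr (posop_psd pB)) opprK.
  apply: le_trans (ler_wpM2l (ltW t1) (bound _)) _.
  by rewrite mulrA mulrC -ler_pdivlMr.
rewrite -[Re (dotp (A _) _)]/(qform rdot A (h y) (h y)).
rewrite -[Re (dotp (B _) _)]/(qform rdot B (h x - v + (v - h y)) (h x - v + (v - h y))).
rewrite -[Re (dotp (F _) _)]/(qform rdot F (h x) (h x)).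
set p := qform rdot A v v in y0 te vx *.
set q := qform rdot B (h x - v) (h x - v) in y0 te vx *.
(* Only one factor 1 + t arises here, while [te] is stated with its square. *)
have : (1 + t) * (p + q) <= (1 + t) ^+ 2 * (p + q).
  by rewrite ler_wpM2r// expr2 ler_peMr//; lra.
rewrite !mulrDr; lra.
Qed.

End ParallelForm.

(* Split a near-optimal decomposition of x for the sum of the two pairs. *)
Lemma form_parallel_superadditive (R : realType) (V : lmodType R[i])
    (a1 b1 g1 a2 b2 g2 a b g : V -> V -> R[i]) :
  is_form_parallel a1 b1 g1 -> is_form_parallel a2 b2 g2 ->
  is_form_parallel a b g ->
  (forall x y, a x y = a1 x y + a2 x y) -> (forall x y, b x y = b1 x y + b2 x y) ->
  forall x, g1 x x + g2 x x <= g x x.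
Proof.
move=> p1 p2 p aE bE x; rewrite lecE.
have := form_parallel_ge0 p1 x; have := form_parallel_ge0 p2 x.
have := form_parallel_ge0 p x; rewrite !complex_ge0E.
move=> /andP[/eqP gi _] /andP[/eqP g2i _] /andP[/eqP g1i _].
apply/andP; split; first by rewrite gi; move: g1i g2i;
  case: (g1 x x) (g2 x x) => ? ? [? ?] /= -> ->; rewrite addr0.
rewrite ReD; apply/ler_addgt0Pr => e e0.
have [y] := form_parallel_upper p x e0; rewrite aE bE !ReD.
have := form_parallel_lower p1 x y; have := form_parallel_lower p2 x y.
lra.
Qed.

(** * Square roots of positive matrices over a von Neumann algebra *)

Section PsdConvergence.
Context {R : realType} {W : lmodType R[i]}.
Variable b : W -> W -> R.
Hypothesis pb : psd_form b.
Local Notation N := (psd_norm b).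

(** Convergence is taken in the seminorm of a form, so that it applies alike to H with [rdot] and to
    the n-fold sum with [sum_dot]. *)
Definition psd_cvg (s : nat -> W) (l : W) :=
  forall e : R, 0 < e -> exists K, forall k, (K <= k)%N -> N (s k - l) <= e.

Definition psd_complete := forall s : nat -> W,
  (forall e : R, 0 < e -> exists K, forall k m, (K <= k)%N -> (K <= m)%N ->
     N (s k - s m) <= e) -> exists l, psd_cvg s l.

Lemma psd_normN x : N (- x) = N x.
Proof. by rewrite /psd_norm (psdNl pb) (psdNr pb) opprK. Qed.

Lemma psd_norm0 : N 0 = 0.
Proof. by rewrite /psd_norm (psd0l pb) sqrtr0. Qed.

Lemma psd_cvg_shift s l : psd_cvg s l -> psd_cvg (fun k => s k.+1) l.
Proof.
move=> sl e e0; have [K Ks] := sl e e0; exists K => k Kk.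
by apply: Ks; exact: leqW.
Qed.

Lemma psd_cvgD s l s' l' : psd_cvg s l -> psd_cvg s' l' ->
  psd_cvg (fun k => s k + s' k) (l + l').
Proof.
move=> sl sl' e e0; have e20 : 0 < e / 2 by lra.
have [K Ks] := sl _ e20; have [K' Ks'] := sl' _ e20.
exists (maxn K K') => k; rewrite geq_max => /andP[/Ks h /Ks' h'].
rewrite opprD addrACA; apply: le_trans (psd_normD pb _ _) _; lra.
Qed.

Lemma psd_cvg_unique s l l' : (forall x, b x x = 0 -> x = 0) ->
  psd_cvg s l -> psd_cvg s l' -> l = l'.
Proof.
move=> def sl sl'; apply/eqP; rewrite -subr_eq0; apply/eqP/def.
rewrite -(sqr_psd_norm pb); apply/eqP; rewrite sqrf_eq0 eq_le psd_norm_ge0 andbT.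
apply/ler_addgt0Pr => e e0; rewrite add0r; have e20 : 0 < e / 2 by lra.
have [K Ks] := sl _ e20; have [K' Ks'] := sl' _ e20.
have := Ks _ (leq_maxl K K'); have := Ks' _ (leq_maxr K K').
set k := maxn K K' => h h'.
have -> : l - l' = (s k - l') - (s k - l) by rewrite opprB [RHS]addrC addrA subrK.
apply: le_trans (psd_normD pb _ _) _; rewrite psd_normN; lra.
Qed.

End PsdConvergence.

Lemma psd_cvg_bounded (R : realType) (W W' : lmodType R[i])
    (b : W -> W -> R) (b' : W' -> W' -> R) (U : W -> W') (c : R) s l :
  0 <= c -> (forall x y, U (x - y) = U x - U y) ->
  (forall x, psd_norm b' (U x) <= c * psd_norm b x) ->
  psd_cvg b s l -> psd_cvg b' (U \o s) (U l).
Proof.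
move=> c0 UB Uc sl e e0; have c1 : 0 < c + 1 by lra.
have [K Ks] := sl (e / (c + 1)) (divr_gt0 e0 c1); exists K => k /Ks.
rewrite ler_pdivlMr// /= -UB => h; apply: le_trans (Uc _) _.
apply: le_trans h; rewrite mulrC ler_wpM2l ?psd_norm_ge0//; lra.
Qed.

Section SquareRootIteration.
Context {R : realType} {W : lmodType R[i]}.
Variable b : W -> W -> R.
Hypotheses (pb : psd_form b) (def : forall x, b x x = 0 -> x = 0).
Hypothesis cplt : psd_complete b.
Hypothesis scaleb : forall a : R[i], exists2 c, 0 <= c &
  forall x : W, psd_norm b (a *: x) <= c * psd_norm b x.
Local Notation N := (psd_norm b).
Variable T : W -> W.
Hypotheses (linT : linear T) (Tle1 : forall x, N (T x) <= N x).
Hypothesis symT : forall x y, b (T x) y = b x (T y).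

(** Fixed-point iteration for 2 L = T + L^2, started at 0. It will be run for T = 1 - X / c, where X
    / c = (1 - L)^2 in the limit. *)
Fixpoint sqrt_iter (k : nat) (x : W) : W :=
  if k is k'.+1 then (2^-1 : R)%:C *: (T x + sqrt_iter k' (sqrt_iter k' x)) else 0.

(** The same recursion with T replaced by the scalar 1. It majorizes the norms of the iterates and
    of their increments. As T may have norm 1, the iteration is not a strict contraction; this
    bounded increasing sequence supplies the Cauchy estimate. *)
Fixpoint sqrt_bound (k : nat) : R :=
  if k is k'.+1 then 2^-1 * (1 + sqrt_bound k' ^+ 2) else 0.

Local Notation Y := sqrt_iter.
Local Notation c := sqrt_bound.

Let c01 k : 0 <= c k <= 1.
Proof.
elim: k => [|k /andP[h0 h1]] /=; first by rewrite lexx ler01.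
by have : c k ^+ 2 <= 1 by [rewrite expr_le1|]; have := sqr_ge0 (c k); lra.
Qed.

Let c_nd k : c k <= c k.+1.
Proof. by have := sqr_ge0 (c k - 1); rewrite sqrrB1 -mulr_natr /=; lra. Qed.

Let linY k : linear (Y k).
Proof.
elim: k => [|k IH] a x y /=; first by rewrite scaler0 addr0.
rewrite linT !IH !scalerDr !scalerA (mulrC a) -!addrA; congr (_ + _).
by rewrite addrCA.
Qed.

Let YB k x y : Y k (x - y) = Y k x - Y k y.
Proof. by have := linY k (-1) y x; rewrite !scaleN1r (addrC (- y)) (addrC (- Y k y)). Qed.

Let symY k x y : b (Y k x) y = b x (Y k y).
Proof.
elim: k x y => [|k IH] x y /=; first by rewrite (psd0l pb) (psdC pb) (psd0l pb).
by rewrite !(psdE pb) symT !IH.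
Qed.

Let halfN x : N ((2^-1 : R)%:C *: x) = 2^-1 * N x.
Proof. by rewrite (psd_normZ pb) ger0_norm// invr_ge0. Qed.

Let boundY k x : N (Y k x) <= c k * N x.
Proof.
elim: k x => [|k IH] x /=; first by rewrite (psd_norm0 pb) mul0r.
rewrite halfN -mulrA ler_wpM2l ?invr_ge0// mulrDl mul1r.
apply: le_trans (psd_normD pb _ _) _; apply: lerD => //.
apply: le_trans (IH _) _; rewrite expr2 -mulrA ler_wpM2l//.
by have /andP[] := c01 k.
Qed.

Let leY1 k x : N (Y k x) <= N x.
Proof.
apply: le_trans (boundY k x) _; rewrite -[leRHS]mul1r ler_wpM2r ?psd_norm_ge0//.
by have /andP[] := c01 k.
Qed.

(** Induction through a^2 - b^2 = a (a - b) + (a - b) b, which holds without commutation. The same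
    splitting for the scalars [c k] has nonnegative terms that bound the operator terms one by
    one. *)
Let stepY k x : N (Y k.+1 x - Y k x) <= (c k.+1 - c k) * N x.
Proof.
elim: k x => [|k IH] x.
  rewrite /= subr0 addr0 halfN expr0n addr0 mulr1 subr0.
  by rewrite ler_wpM2l ?invr_ge0.
have -> : Y k.+2 x - Y k.+1 x = (2^-1 : R)%:C *:
    (Y k.+1 (Y k.+1 x - Y k x) + (Y k.+1 (Y k x) - Y k (Y k x))).
  rewrite YB addrA subrK -[Y k.+2 x]/(_ *: (T x + Y k.+1 (Y k.+1 x))).
  rewrite -[X in _ - X]/(_ *: (T x + Y k (Y k x))) -scalerBr; congr (_ *: _).
  by rewrite opprD addrACA subrr add0r.
rewrite halfN.
have -> : c k.+2 - c k.+1 = 2^-1 * (c k.+1 * (c k.+1 - c k) + (c k.+1 - c k) * c k).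
  rewrite -[c k.+2]/(2^-1 * (1 + c k.+1 ^+ 2)) -[X in _ - X = _]/(2^-1 * (1 + c k ^+ 2)).
  by ring.
rewrite -mulrA ler_wpM2l ?invr_ge0// mulrDl.
apply: le_trans (psd_normD pb _ _) _; apply: lerD.
  apply: le_trans (boundY _ _) _; rewrite -mulrA ler_wpM2l//.
  by have /andP[] := c01 k.+1.
apply: le_trans (IH _) _; rewrite -mulrA ler_wpM2l// subr_ge0; exact: c_nd.
Qed.

Let distY k m x : N (Y (k + m) x - Y k x) <= (c (k + m) - c k) * N x.
Proof.
elim: m => [|m IH]; first by rewrite addn0 !subrr (psd_norm0 pb) mul0r.
rewrite addnS.
have -> : Y (k + m).+1 x - Y k x =
    (Y (k + m).+1 x - Y (k + m) x) + (Y (k + m) x - Y k x) by rewrite addrA subrK.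
apply: le_trans (psd_normD pb _ _) _.
have := stepY (k + m) x; move: IH; rewrite !mulrBl; lra.
Qed.

Let c_cauchy e : 0 < e -> exists K, forall k, (K <= k)%N -> c k - c K <= e.
Proof.
move=> e0; have ubc : has_sup (range c).
  by split; [exists (c 0), 0%N|exists 1 => _ [k _ <-]; have /andP[] := c01 k].
have [_ [K _ <-] Ke] := sup_adherent e0 ubc.
exists K => k _; have : c k <= sup (range c) by apply: ub_le_sup; [exact: ubc.2|exists k].
by move: Ke; lra.
Qed.

Let cauchyY x (e : R) : 0 < e -> exists K, forall k m, (K <= k)%N -> (K <= m)%N ->
  N (Y k x - Y m x) <= e.
Proof.
move=> e0; have N1 : 0 < 2 * (N x + 1) by have := psd_norm_ge0 b x; lra.
have [K cK] := c_cauchy (divr_gt0 e0 N1); exists K => k m Kk Km.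
have hK j : (K <= j)%N -> N (Y j x - Y K x) <= e / 2.
  move=> Kj; have := distY K (j - K) x; rewrite subnKC// => /le_trans; apply.
  have := cK _ Kj; rewrite ler_pdivlMr// => h.
  have := c01 K; have := psd_norm_ge0 b x => Nx _.
  have cc : 0 <= c j - c K.
    rewrite subr_ge0 -(subnKC Kj); elim: (j - K)%N => [|i IH]; first by rewrite addn0.
    by rewrite addnS; apply: le_trans IH _; exact: c_nd.
  by move: h cc; nra.
have -> : Y k x - Y m x = (Y k x - Y K x) - (Y m x - Y K x).
  by rewrite opprB addrA subrK.
apply: le_trans (psd_normD pb _ _) _; rewrite (psd_normN pb).
have := hK _ Kk; have := hK _ Km; lra.
Qed.

(* The solution of 2 L = T + L ^ 2, so that (1 - L) ^ 2 = 1 - T. *)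
Lemma sqrt_iter_limit : exists L : W -> W,
  [/\ forall x, psd_cvg b (Y ^~ x) (L x),
      linear L, forall x, N (L x) <= N x,
      forall x y, b (L x) y = b x (L y) &
      forall x, L x + L x = T x + L (L x)].
Proof.
have ex x : exists l, psd_cvg b (Y ^~ x) l by apply: cplt; exact: cauchyY.
pose L x := sval (cid (ex x)).
have YL x : psd_cvg b (Y ^~ x) (L x) by exact: svalP (cid (ex x)).
exists L; split=> //.
- move=> a x y; apply: (psd_cvg_unique pb def (YL _)).
  have [ca ca0 aE] := scaleb a.
  have -> : Y ^~ (a *: x + y) = (fun k => a *: Y k x + Y k y).
    by apply/funext => k; exact: linY.
  apply: (psd_cvgD pb) => //.
  exact: (psd_cvg_bounded ca0 (scalerBr a) aE (YL x)).
- move=> x; apply/ler_addgt0Pr => e e0; have [K /(_ K (leqnn K)) h] := YL x e e0.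
  have -> : L x = Y K x - (Y K x - L x) by rewrite subKr.
  apply: le_trans (psd_normD pb _ _) _; rewrite (psd_normN pb).
  have := leY1 K x; lra.
- have close x y e : 0 < e -> exists K, forall k, (K <= k)%N ->
      `|b (Y k x) y - b (L x) y| <= e.
    move=> e0; have N1 : 0 < N y + 1 by have := psd_norm_ge0 b y; lra.
    have [K hK] := YL x _ (divr_gt0 e0 N1); exists K => k /hK.
    rewrite ler_pdivlMr// => h.
    have -> : b (Y k x) y - b (L x) y = b (Y k x - L x) y.
      by rewrite (psdDl pb) (psdNl pb).
    have h1 := psd_CauchySchwarz_norm pb (Y k x - L x) y.
    have h2 := psd_CauchySchwarz_norm pb (- (Y k x - L x)) y.
    move: h2; rewrite (psdNl pb) (psd_normN pb) => h2.
    have := psd_norm_ge0 b (Y k x - L x).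
    by rewrite ler_norml; move: h h1 h2; rewrite mulrDr mulr1; lra.
  move=> x y; apply/eqP; rewrite -subr_eq0 -normr_eq0 eq_le normr_ge0 andbT.
  apply/ler_addgt0Pr => e e0; rewrite add0r; have e20 : 0 < e / 2 by lra.
  have [K hK] := close x y _ e20; have [K' hK'] := close y x _ e20.
  have := hK _ (leq_maxl K K'); have := hK' _ (leq_maxr K K').
  rewrite symY (psdC pb (L y)) (psdC pb y); set z := b (Y _ x) y.
  by rewrite !ler_norml; lra.
(* The iterates converge only pointwise; the uniform bound [leY1] allows their argument to vary with
   k. *)
- move=> x; have h : psd_cvg b (fun k => Y k (Y k x)) (L (L x)).
    move=> e e0; have e20 : 0 < e / 2 by lra.
    have [K hK] := YL x _ e20; have [K' hK'] := YL (L x) _ e20.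
    exists (maxn K K') => k; rewrite geq_max => /andP[/hK h1 /hK' h2].
    have -> : Y k (Y k x) - L (L x) = Y k (Y k x - L x) + (Y k (L x) - L (L x)).
      by rewrite YB addrA subrK.
    apply: le_trans (psd_normD pb _ _) _; have := leY1 k (Y k x - L x); lra.
  have Tx : psd_cvg b (fun=> T x) (T x).
    by move=> e e0; exists 0%N => k _; rewrite subrr (psd_norm0 pb) ltW.
  apply: (psd_cvg_unique pb def _ (psd_cvgD pb Tx h)).
  have -> : (fun k => T x + Y k (Y k x)) = (fun k => Y k.+1 x + Y k.+1 x).
    apply/funext => k /=; rewrite -scalerDl -rmorphD.
    have -> : (2^-1 + 2^-1 : R) = 1 by field.
    by rewrite scale1r.
  by apply: (psd_cvgD pb); exact: (psd_cvg_shift (YL x)).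
Qed.

End SquareRootIteration.

Section HilbertSum.
Context {R : realType} {H : hilbert R} (n : nat).
Local Notation W := ('I_n -> H).
Implicit Types (x y : W) (i j : 'I_n) (u v : H).

Definition sum_dot (x y : W) : R := \sum_i rdot (x i) (y i).

Lemma sum_dot_psd : psd_form sum_dot.
Proof.
split=> [x y z|r x y|x y|x]; rewrite /sum_dot.
- by rewrite -big_split; apply: eq_bigr => i _; rewrite (psdDl rdot_psd).
- by rewrite mulr_sumr; apply: eq_bigr => i _; rewrite (psdZl rdot_psd).
- by apply: eq_bigr => i _; rewrite (psdC rdot_psd).
- by apply: sumr_ge0 => i _; exact: (psd_ge0 rdot_psd).
Qed.

Local Notation N := (psd_norm sum_dot).

Lemma sum_dot_eq0 x : sum_dot x x = 0 -> x = 0.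
Proof.
move=> /eqP; rewrite psumr_eq0 => [/allP x0|i _]; last exact: (psd_ge0 rdot_psd).
by apply/funext => i; apply/rdot_eq0/eqP/x0; rewrite mem_index_enum.
Qed.

Lemma hnrm_le_sum x i : hnrm (x i) <= N x.
Proof.
rewrite ler_sqrt ?(psd_ge0 sum_dot_psd)// /sum_dot (bigD1 i)//= lerDl.
by apply: sumr_ge0 => j _; exact: (psd_ge0 rdot_psd).
Qed.

Lemma hnrmZ (a : R[i]) u : hnrm (a *: u) = Re `|a| * hnrm u.
Proof.
by apply: complexI; rewrite rmorphM /= -!normE normrZ; congr (_ * _).
Qed.

(** [psd_form] speaks of real scalars; this estimate for complex ones makes the limit of the square
    root iteration complex linear. *)
Lemma sum_norm_scale (a : R[i]) : exists2 c : R, 0 <= c &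
  forall x, N (a *: x) <= c * N x.
Proof.
have a0 : 0 <= Re `|a| by have := normr_ge0 a; rewrite complex_ge0E => /andP[].
exists (Re `|a|) => // x.
rewrite -ler_sqr ?nnegrE ?mulr_ge0 ?psd_norm_ge0// exprMn.
rewrite !(sqr_psd_norm sum_dot_psd) /sum_dot mulr_sumr ler_sum// => i _.
by rewrite -!(sqr_psd_norm rdot_psd) -exprMn -/(hnrm _) -/(hnrm (x i)) -hnrmZ.
Qed.

Definition inj_at j u : W := fun i => if i == j then u else 0.

Lemma inj_at_sum x : x = \sum_j inj_at j (x j).
Proof.
apply/funext => i; rewrite fct_sumE (bigD1 i)//= /inj_at eqxx big1 ?addr0// => j ji.
by rewrite eq_sym (negbTE ji).
Qed.

Lemma inj_at_linear j : linear (inj_at j).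
Proof.
by move=> a u v; apply/funext => i; rewrite /inj_at !fctE; case: ifP => // _;
  rewrite scaler0 addr0.
Qed.

Lemma sum_dot_inj_at x j u : sum_dot x (inj_at j u) = rdot (x j) u.
Proof.
rewrite /sum_dot (bigD1 j)//= /inj_at eqxx big1 ?addr0// => i /negbTE ->.
by rewrite (psdC rdot_psd) (psd0l rdot_psd).
Qed.

Lemma norm_inj_at j u : N (inj_at j u) = hnrm u.
Proof.
rewrite /psd_norm /hnrm /psd_norm /sum_dot (bigD1 j)//= /inj_at eqxx big1 ?addr0//.
by move=> i /negbTE ->; exact: (psd0l rdot_psd).
Qed.

Lemma sum_norm_le x : N x <= \sum_i hnrm (x i).
Proof.
rewrite {1}(inj_at_sum x); elim/big_ind2: _ => [|x1 r1 x2 r2 h1 h2|i _].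
- by rewrite (psd_norm0 sum_dot_psd).
- by apply: le_trans (psd_normD sum_dot_psd _ _) _; exact: lerD.
- by rewrite norm_inj_at.
Qed.

Lemma sum_dot_complete : psd_complete sum_dot.
Proof.
move=> s cs.
have lim i : exists l : H, forall e : R, 0 < e ->
    exists K, forall k, (K <= k)%N -> hnrm (s k i - l) <= e.
  have : cauchy ((fun k => s k i) @ \oo).
    (* Radii of balls are complex numbers; a positive one has zero imaginary part. *)
    apply: cauchy_exP => -[e e'] /=; rewrite ltcE /= => /andP[/eqP -> e0].
    have e20 : 0 < e / 2 by lra.
    have [K sK] := cs _ e20; exists (s K i); exists K => // k Kk.
    rewrite -ball_normE /= normE ltcR.
    have := hnrm_le_sum (s K - s k) i; have := sK K k (leqnn _) Kk.
    by rewrite !fctE; lra.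
  move=> /cauchy_cvg /cvg_ex[l sl]; exists l => e e0.
  have eC : 0 < e%:C by rewrite ltcR.
  move/cvgrPdist_lt: sl => /(_ _ eC)[K _ hK]; exists K => k /hK.
  by rewrite /= distrC normE ltcR => /ltW.
pose l i := sval (cid (lim i)); exists l => e e0.
(* Dividing by n + 1 instead of n also covers the empty sum. *)
have n0 : 0 < n%:R + 1 :> R by have := ler0n R n; lra.
have /choice[K hK] i : exists K, forall k, (K <= k)%N -> hnrm (s k i - l i) <= e / (n%:R + 1).
  exact: (svalP (cid (lim i)) _ (divr_gt0 e0 n0)).
exists (\max_i K i) => k Kk; apply: le_trans (sum_norm_le _) _.
apply: (@le_trans _ _ (\sum_(i < n) e / (n%:R + 1))).
  by apply: ler_sum => i _; apply: hK; apply: leq_trans Kk; exact: leq_bigmax.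
rewrite sumr_const card_ord -[leLHS]mulr_natr mulrAC ler_pdivrMr//.
by rewrite mulrDr mulr1 lerDl ltW.
Qed.

End HilbertSum.

Section VNMatrices.
Context {R : realType} {H : hilbert R} (M : vonNeumann H).
Implicit Types (x y : M) (u v : H).

Lemma vn_addE x y u : (x + y : M) u = x u + y u.
Proof. by []. Qed.

Lemma vn_scaleE (a : R[i]) x u : (a *: x : M) u = a *: x u.
Proof. by []. Qed.

Lemma vn_sumE (I : Type) (s : seq I) (f : I -> M) u :
  (\sum_(i <- s) f i : M) u = \sum_(i <- s) f i u.
Proof. exact: (big_morph (fun x : M => x u) (fun _ _ => erefl) erefl). Qed.

Lemma vn_ext x y : (forall u, x u = y u) -> x = y.
Proof. by move=> xy; apply: val_inj; apply/funext. Qed.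

Lemma vn_id_subproof : (@idfun H) \in vn_pred M.
Proof.
apply/vn_predP; rewrite -vn_bicommutant; split=> // .
by split=> // u; exact: cvg_id.
Qed.

Definition vn_one : M := VNElt vn_id_subproof.

Lemma vn_star_eq x y : (forall u v, rdot (x u) v = rdot u (y v)) -> y = vn_star x.
Proof.
move=> xy; apply: vn_ext => v; apply: rdot_ext => u.
by rewrite -xy /rdot vn_starP.
Qed.

(** A bicommutant is closed under pointwise limits: a bounded U commuting with every [s k] commutes
    with T in the limit. The norm bound makes T continuous. *)
Lemma vn_limit (s : nat -> M) (T : H -> H) : linear T ->
  (forall u, hnrm (T u) <= hnrm u) ->
  (forall u, psd_cvg rdot (fun k => s k u) (T u)) -> T \in vn_pred M.
Proof.
move=> linT T1 sT; apply/vn_predP; rewrite -vn_bicommutant; split.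
  split=> //.
  pose f : {linear H -> H} := HB.pack T (GRing.isLinear.Build _ _ _ _ T linT).
  apply: (@bounded_linear_continuous _ _ _ f); apply/linear_boundedP.
  exists 1; split=> // r r1 u; rewrite /= !normE.
  apply: (@le_trans _ _ (hnrm u)%:C); first by rewrite lecR.
  by rewrite ler_peMl ?ler0c ?psd_norm_ge0// ltW.
move=> U [bU cU]; apply/funext => u /=.
have [c c0 Uc] := boundedop_hnrm bU.
apply: (psd_cvg_unique rdot_psd rdot_eq0 (sT (U u))).
have -> : (fun k => s k (U u)) = U \o (fun k => s k u).
  apply/funext => k; rewrite /= -[RHS]/((U \o s k) u) cU//.
  by apply/vn_predP; exact: vn_opP.
apply: (psd_cvg_bounded (ltW c0) _ Uc (sT u)) => a a'.
by rewrite (linear_opB bU.1).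
Qed.

Variable n : nat.
Local Notation W := ('I_n -> H).
Implicit Types (Z : 'M[M]_n) (xi eta : W).

Definition mxact Z (xi : W) : W := fun i => \sum_j Z i j (xi j).

Lemma mxact_linear Z : linear (mxact Z).
Proof.
move=> a xi eta; apply/funext => i; rewrite /mxact !fctE scaler_sumr -big_split.
by apply: eq_bigr => j _; rewrite vn_linear.
Qed.

Lemma mxact_inj Z i j u : mxact Z (inj_at j u) i = Z i j u.
Proof.
rewrite /mxact (bigD1 j)//= /inj_at eqxx big1 ?addr0// => k /negbTE ->.
exact: linear_op0 (vn_linear _).
Qed.

Lemma mxposE (X : 'M[M]_n) xi :
  \sum_i \sum_j dotp (X i j (xi j)) (xi i) = \sum_i dotp (mxact X xi i) (xi i).
Proof. by apply: eq_bigr => i _; rewrite dotp_suml. Qed.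

Lemma mxact_bounded (X : 'M[M]_n) : exists2 c : R, 0 < c &
  forall xi, sum_dot (mxact X xi) xi <= c * sum_dot xi xi.
Proof.
have /choice[c cX] (p : 'I_n * 'I_n) : exists c : R,
    0 < c /\ forall u, hnrm (X p.1 p.2 u) <= c * hnrm u.
  have bX : boundedop (X p.1 p.2) by apply: (@vn_bounded _ _ M); apply/vn_predP; exact: vn_opP.
  by have [c c0 Xc] := boundedop_hnrm bX; exists c.
have cs0 : 0 <= \sum_i \sum_j c (i, j).
  by apply: sumr_ge0 => i _; apply: sumr_ge0 => j _; exact: ltW (cX (i, j)).1.
(* The summand 1 keeps the constant positive, so that it can be inverted, even if all other terms
   vanish. *)
exists (1 + \sum_i \sum_j c (i, j)) => [|xi]; first by lra.
apply: (@le_trans _ _ ((\sum_i \sum_j c (i, j)) * sum_dot xi xi)); last first.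
  by rewrite mulrDl mul1r lerDr (psd_ge0 (sum_dot_psd n)).
rewrite /sum_dot mulr_suml; apply: ler_sum => i _; rewrite -/(sum_dot xi xi).
rewrite {1}/rdot dotp_suml Re_sum mulr_suml; apply: ler_sum => j _.
apply: le_trans (psd_CauchySchwarz_norm rdot_psd _ _) _.
rewrite -(sqr_psd_norm (sum_dot_psd n)) expr2 mulrA.
apply: ler_pM; rewrite ?psd_norm_ge0//; last exact: hnrm_le_sum.
apply: le_trans ((cX (i, j)).2 _) _.
by rewrite ler_wpM2l ?(ltW (cX _).1)//; exact: hnrm_le_sum.
Qed.

Lemma mxpos_psd (X : 'M[M]_n) : mxpos X -> psd_form (qform (@sum_dot _ _ n) (mxact X)).
Proof.
move=> pX.
have -> : qform (@sum_dot _ _ n) (mxact X) =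
    fun xi eta => Re (\sum_i dotp (mxact X xi i) (eta i)).
  by apply/funext => x; apply/funext => y; rewrite Re_sum.
apply: sesquilinear_psd => [a x y z|a x y z|x].
- rewrite mxact_linear mulr_sumr -big_split; apply: eq_bigr => i _.
  exact: dotpPl.
- by rewrite mulr_sumr -big_split; apply: eq_bigr => i _; exact: dotpPr.
- by rewrite -mxposE; exact: pX.
Qed.

Let op_in_M (Y : W -> W) := exists Z, Y = mxact Z.

Let op_in_M_step (T Y : W -> W) : op_in_M T -> op_in_M Y ->
  op_in_M (fun xi => (2^-1 : R)%:C *: (T xi + Y (Y xi))).
Proof.
move=> [ZT ->] [Z ->].
exists (\matrix_(i, j) ((2^-1 : R)%:C *: (ZT i j + \sum_k vn_mul (Z i k) (Z k j)))).
apply/funext => xi; apply/funext => i; rewrite !fctE /mxact.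
under [in RHS]eq_bigr => j _ do rewrite mxE vn_scaleE vn_addE vn_sumE.
rewrite -scaler_sumr big_split /=; congr (_ *: (_ + _)).
rewrite exchange_big; apply: eq_bigr => k _.
by rewrite (linear_op_sum (vn_linear _)).
Qed.

Let op_in_M_iter (T : W -> W) k : op_in_M T -> op_in_M (sqrt_iter T k).
Proof.
move=> MT; elim: k => [|k IH]; last exact: op_in_M_step.
exists (\matrix_(i, j) 0); apply/funext => xi; apply/funext => i.
by rewrite /mxact big1// => j _; rewrite mxE.
Qed.

(** With c bounding X, the operator T = 1 - X / c satisfies 0 <= T <= 1, and the limit L of the
    iteration gives the symmetric square root S = sqrt(c) (1 - L) of X. Entries of L are pointwise
    limits of entries of matrices over M, so Z is the matrix of S. By symmetry Z is its own adjoint,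
    which turns S S = X into the required factorization. *)
Lemma mxpos_factor (X : 'M[M]_n) : mxpos X -> exists Z : 'M[M]_n,
  forall i j, X i j = \sum_k vn_mul (vn_star (Z k i)) (Z k j).
Proof.
move=> pX; have pb := @sum_dot_psd _ H n.
have qX := mxpos_psd pX; have [c c0 Xc] := mxact_bounded X.
have linX := mxact_linear X.
pose T xi : W := xi - (c^-1)%:C *: mxact X xi.
have linT : linear T.
  move=> a xi eta; rewrite /T linX scalerDr !scalerA (mulrC _ a) -scalerA opprD.
  by rewrite addrACA -scalerN -scalerDr.
have TE xi eta : sum_dot (T xi) eta = sum_dot xi eta - c^-1 * qform (@sum_dot _ _ n) (mxact X) xi eta.
  by rewrite /T /qform (psdDl pb) (psdNl pb) (psdZl pb).
have symT xi eta : sum_dot (T xi) eta = sum_dot xi (T eta).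
  by rewrite TE (psdC pb _ (T eta)) TE (psdC qX) (psdC pb eta).
have pT : psd_form (qform (@sum_dot _ _ n) T).
  split=> [x y z|r x y|x y|x]; rewrite /qform.
  - by rewrite !TE (psdDl pb) (psdDl qX) mulrDr opprD addrACA.
  - by rewrite !TE (psdZl pb) (psdZl qX) mulrCA mulrBr.
  - by rewrite symT (psdC pb).
  - by rewrite TE subr_ge0 mulrC ler_pdivrMr// mulrC; exact: Xc.
(* From 0 <= T <= 1, [psd_op_sqr] gives T^2 <= T <= 1. *)
have T1 xi : psd_norm (@sum_dot _ _ n) (T xi) <= psd_norm (@sum_dot _ _ n) xi.
  have Tle (y : W) : qform (@sum_dot _ _ n) T y y <= 1 * sum_dot y y.
    by rewrite mul1r /qform TE gerBl mulr_ge0 ?invr_ge0 ?(ltW c0)// (psd_ge0 qX).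
  rewrite ler_sqrt ?(psd_ge0 pb)//.
  apply: le_trans (psd_op_sqr pb ler01 pT Tle xi) _; rewrite mul1r.
  by rewrite -[leRHS]mul1r; exact: Tle.
have MT : op_in_M T.
  exists (\matrix_(i, j) ((i == j)%:R *: vn_one - (c^-1)%:C *: X i j)).
  apply/funext => xi; apply/funext => i; rewrite /T !fctE /mxact.
  under [RHS]eq_bigr => j _ do rewrite mxE -scaleNr vn_addE !vn_scaleE.
  rewrite big_split /= -scaler_sumr scaleNr; congr (_ - _).
  rewrite (bigD1 i)//= eqxx scale1r big1 ?addr0// => j.
  by rewrite eq_sym => /negbTE ->; rewrite scale0r.
have [L [sL linL L1 symL LE]] :=
  sqrt_iter_limit pb (@sum_dot_eq0 _ H n) (@sum_dot_complete _ H n)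
    (@sum_norm_scale _ H n) linT T1 symT.
have ML i j : (fun u => L (inj_at j u) i) \in vn_pred M.
  have /choice[Zs ZsE] k := op_in_M_iter k MT.
  apply: (@vn_limit (fun k => Zs k i j)).
  - by move=> a u v; rewrite (inj_at_linear j) linL.
  - move=> u; apply: le_trans (hnrm_le_sum _ _) _; rewrite -(norm_inj_at j u).
    exact: L1.
  - move=> u e e0; have [K hK] := sL (inj_at j u) e e0; exists K => k /hK.
    apply: le_trans; rewrite -mxact_inj -ZsE.
    exact: (hnrm_le_sum (sqrt_iter T k (inj_at j u) - L (inj_at j u)) i).
pose S xi : W := (Num.sqrt c)%:C *: (xi - L xi).
pose Z : 'M[M]_n := \matrix_(i, j)
  ((Num.sqrt c)%:C *: ((i == j)%:R *: vn_one - VNElt (ML i j))).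
have ZE i j u : Z i j u = S (inj_at j u) i.
  rewrite mxE /S !fctE vn_scaleE; congr (_ *: (_ - _)).
  by rewrite -[LHS]/((i == j)%:R *: u) /inj_at; case: eqP => _; rewrite ?scale1r ?scale0r.
have linS : linear S.
  move=> a xi eta; rewrite /S linL scalerA mulrC -scalerA -scalerDr; congr (_ *: _).
  by rewrite scalerBr opprD addrACA.
have symS xi eta : sum_dot (S xi) eta = sum_dot xi (S eta).
  by rewrite /S !(psdE pb) symL.
have SS xi : S (S xi) = mxact X xi.
  have sc2 : (Num.sqrt c)%:C * (Num.sqrt c)%:C = c%:C.
    by rewrite -rmorphM -expr2 sqr_sqrtr// ltW.
  rewrite /S (linear_opZ linL) (linear_opB linL) -scalerBr scalerA sc2.
  have -> : xi - L xi - (L xi - L (L xi)) = (c^-1)%:C *: mxact X xi.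
    have -> : xi - L xi - (L xi - L (L xi)) = xi - (L xi + L xi) + L (L xi).
      by rewrite opprB opprD !addrA addrAC.
    by rewrite LE opprD addrA subrK /T subKr.
  by rewrite scalerA -rmorphM divff ?scale1r// gt_eqF.
have SE xi i : S xi i = \sum_j Z i j (xi j).
  rewrite {1}(inj_at_sum xi) (linear_op_sum linS) fct_sumE.
  by apply: eq_bigr => j _; rewrite ZE.
exists Z => i j.
have starZ k : Z i k = vn_star (Z k i).
  apply: vn_star_eq => u v; rewrite !ZE.
  by rewrite -!sum_dot_inj_at symS (psdC pb) sum_dot_inj_at (psdC rdot_psd).
apply: vn_ext => u; rewrite -mxact_inj -SS SE vn_sumE.
by apply: eq_bigr => k _; rewrite -starZ -ZE.
Qed.

End VNMatrices.

Lemma mxpos_gram (R : realType) (H : hilbert R) (M : vonNeumann H) (n : nat)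
    (X Z : 'M[M]_n) :
  (forall i j, X i j = \sum_k vn_mul (vn_star (Z k i)) (Z k j)) -> mxpos X.
Proof.
move=> XE xi.
have -> : \sum_i \sum_j dotp (X i j (xi j)) (xi i) =
    \sum_k dotp (mxact Z xi k) (mxact Z xi k).
  transitivity (\sum_i \sum_k \sum_j dotp (Z k j (xi j)) (Z k i (xi i))).
    apply: eq_bigr => i _; rewrite exchange_big; apply: eq_bigr => j _.
    rewrite XE vn_sumE dotp_suml; apply: eq_bigr => k _.
    by rewrite dotpC -[dotp (xi i) _]vn_starP [RHS]dotpC.
  rewrite exchange_big; apply: eq_bigr => k _.
  rewrite /mxact dotp_sumr; apply: eq_bigr => i _; by rewrite dotp_suml.
by apply: sumr_ge0 => k _; exact: dotp_ge0.
Qed.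

(* Positive matrices are sums of squares, so *-isomorphisms reflect positivity. *)
Lemma mxpos_star_iso (R : realType) (H L : hilbert R) (M : vonNeumann H)
    (N : vonNeumann L) (pi : M -> N) (n : nat) (X : 'M[M]_n) :
  star_iso pi -> mxpos (map_mx pi X) -> mxpos X.
Proof.
move=> [linpi [rho piK rhoK] piM piS] /mxpos_factor[Z XZ].
apply: (@mxpos_gram _ _ _ _ _ (map_mx rho Z)) => i j; apply: (can_inj piK).
rewrite (linear_op_sum linpi); have := XZ i j; rewrite mxE => ->.
by apply: eq_bigr => k _; rewrite !mxE piM piS !rhoK.
Qed.

(** * Parallel sums of completely positive maps *)

Section ParallelSumCP.
Context {R : realType} {H L : hilbert R} {M : vonNeumann H} {N : vonNeumann L}.
Variable SF : standard_form N.

(** Both sides are sums over the same representatives of s and t, so the identity is termwise. *)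
Lemma cp_formD (Phi Psi : M -> N) (s t : tensor M (L2 SF)) :
  cp_form (Phi \+ Psi) s t = cp_form Phi s t + cp_form Psi s t.
Proof.
have [linrep _ _ _] := L2rep_iso SF.
rewrite /cp_form -big_split; apply: eq_bigr => p _; rewrite -big_split.
by apply: eq_bigr => q _; rewrite /= (linear_opD linrep) vn_addE dotpDl.
Qed.

Lemma parallel_form_tensor (Theta : M -> N) (alpha beta gamma : tensor M (L2 SF) -> _) n
    (z : 'I_n -> M) (xi : 'I_n -> L2 SF) :
  is_form_parallel alpha beta gamma ->
  (forall (x y : M) (u v : L2 SF),
     dotp (L2rep SF (Theta (vn_mul (vn_star y) x)) u) v = gamma (pure x u) (pure y v)) ->
  gamma (\sum_j pure (z j) (xi j)) (\sum_i pure (z i) (xi i)) =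
  \sum_i \sum_j dotp (L2rep SF (Theta (vn_mul (vn_star (z i)) (z j))) (xi j)) (xi i).
Proof.
move=> par gE; rewrite (form_parallel_sum par) exchange_big.
by apply: eq_bigr => i _; apply: eq_bigr => j _; rewrite gE.
Qed.

End ParallelSumCP.

Theorem proposition3p14 (R : realType) (H L : hilbert R)
    (M : vonNeumann H) (N : vonNeumann L) (SF : standard_form N)
    (Phi1 Phi2 Psi1 Psi2 : M -> N)
    (cpPhi1 : is_cp Phi1) (cpPhi2 : is_cp Phi2)
    (cpPsi1 : is_cp Psi1) (cpPsi2 : is_cp Psi2)
    (Theta1 Theta2 Theta : M -> N)
    (sum1 : is_parallel_sum SF Phi1 Psi1 Theta1)
    (sum2 : is_parallel_sum SF Phi2 Psi2 Theta2)
    (sum12 : is_parallel_sum SF (Phi1 \+ Phi2) (Psi1 \+ Psi2) Theta) :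
  cp_le (Theta1 \+ Theta2) Theta.
Proof.
have [[lin1 _] [g1 par1 g1E]] := sum1.
have [[lin2 _] [g2 par2 g2E]] := sum2.
have [[lin _] [g par gE]] := sum12.
have [linrep _ _ _] := L2rep_iso SF.
have linD : linear (Theta \- (Theta1 \+ Theta2)).
  move=> a x y; rewrite /= lin lin1 lin2 addrACA -scalerDr opprD addrACA.
  by rewrite -scalerBr.
split=> // n X /mxpos_factor[Z XZ]; apply: (mxpos_star_iso (L2rep_iso SF)) => xi.
pose t k := \sum_j pure (Z k j) (xi j).
suff -> : \sum_i \sum_j dotp (map_mx (L2rep SF)
      (map_mx (Theta \- (Theta1 \+ Theta2)) X) i j (xi j)) (xi i) =
    \sum_k (g (t k) (t k) - (g1 (t k) (t k) + g2 (t k) (t k))).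
  apply: sumr_ge0 => k _; rewrite subr_ge0.
  exact: (form_parallel_superadditive par1 par2 par (cp_formD _ _) (cp_formD _ _)).
transitivity (\sum_i \sum_k \sum_j
    dotp (L2rep SF ((Theta \- (Theta1 \+ Theta2)) (vn_mul (vn_star (Z k i)) (Z k j))) (xi j)) (xi i)).
  apply: eq_bigr => i _; rewrite exchange_big; apply: eq_bigr => j _.
  by rewrite !mxE XZ (linear_op_sum linD) (linear_op_sum linrep) vn_sumE dotp_suml.
rewrite exchange_big; apply: eq_bigr => k _; rewrite /t.
rewrite (parallel_form_tensor _ _ par gE) (parallel_form_tensor _ _ par1 g1E).
rewrite (parallel_form_tensor _ _ par2 g2E) -big_split -sumrB; apply: eq_bigr => i _.
rewrite -big_split -sumrB; apply: eq_bigr => j _ /=.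
rewrite (linear_opB linrep) (linear_opD linrep).
by rewrite -dotpDl /dotp -linearBl.
Qed.
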